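(* Let $c\ge1$, $\lambda_1,\lambda_2,\mu_1,\mu_2>0$, let $X$ be the Markov chain described in the context with $X(0)=(0,0)$, and fix $\alpha$ with $\mathrm{Re}\,\alpha>0$. Then for every integer $i\ge0$, $$\boldsymbol{\pi}_{i+1}(\alpha)=\boldsymbol{\pi}_i(\alpha)A_1N_{i+1}(\alpha)+\sum_{k=0}^{i}\boldsymbol{\pi}_k(\alpha)\sum_{l=i+1}^{\infty}W_{l-k}(\alpha)G_{l,i+1}(\alpha)N_{i+1}(\alpha),$$ with the convention $G_{i+1,i+1}(\alpha)=I$.
   Context: The Markov chain $X$ on $\mathbb{N}_0^2$ has only nonzero off-diagonal rates $q((i,j),(i+1,j))=\lambda_1$, $q((i,j),(i,j+1))=\lambda_2$ ($i,j\ge0$), $q((i,j),(i-1,j))=\max(\min(i,c-j),0)\mu_1$ ($i\ge1$), $q((i,j),(i,j-1))=\min(c,j)\mu_2$ ($j\ge1$). $\pi_x(\alpha)=\int_0^\infty e^{-\alpha t}P(X(t)=x\mid X(0)=(0,0))\,dt$, and $\boldsymbol{\pi}_i(\alpha)=[\pi_{(i,0)}(\alpha),\dots,\pi_{(i,c-1)}(\alpha)]$ (a $1\times c$ row vector). For $A\subset\mathbb{N}_0^2$, $\tau_A=\inf\{t>0:X(t^-)\ne X(t)\in A\}$, and $E_z$ denotes expectation given $X(0)=z$. Lower level $i$ is $L_i=\{(i,0),\dots,(i,c-1)\}$. All $c\times c$ matrices have rows/columns indexed $0,\dots,c-1$. $A_1=\lambda_1I$. For $\lambda,\mu,\theta>0$,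 $m\ge0$: $w^{\lambda,\mu,\theta}_m(\alpha)=E[e^{-\alpha B}\mathbf{1}\{\Lambda_\theta(B)=m\}]$, where $B$ is the busy period of an $M/M/1$ queue (arrival rate $\lambda$, service rate $\mu$) started with one customer and $\Lambda_\theta$ is an independent Poisson process of rate $\theta$. $W_m(\alpha)$ is the $c\times c$ matrix whose only nonzero entry is $(W_m(\alpha))_{c-1,c-1}=\lambda_2w^{\lambda_2,c\mu_2,\lambda_1}_m(\alpha)$. For $i>j\ge0$, $(G_{i,j}(\alpha))_{k,l}=E_{(i,k)}[e^{-\alpha\tau_{L_j}}\mathbf{1}\{X(\tau_{L_j})=(j,l)\}]$. For $i\ge1$, $(N_i(\alpha))_{k,l}=E_{(i,k)}\bigl[\int_0^{\tau_{L_{i-1}}}e^{-\alpha t}\mathbf{1}\{X(t)=(i,l)\}\,dt\bigr]$. *)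

(* Defs.v *)
From HB Require Import structures.
From mathcomp Require Import all_boot all_order all_algebra.
From mathcomp Require Import all_classical all_reals all_analysis.
From mathcomp Require Import complex.
Set Implicit Arguments. Unset Strict Implicit. Unset Printing Implicit Defensive.
Import Order.TTheory GRing.Theory Num.Theory.
Import numFieldNormedType.Exports.
Local Open Scope classical_set_scope.
Local Open Scope ring_scope.

Definition state := (nat * nat)%type.

Section Defs.
Variable R : realType.
Local Notation C := (R[i]).
Local Notation Re := complex.Re.
Local Notation Im := complex.Im.
Local Notation toC x := (Complex x 0).

Definition cexpn (alpha : C) (t : R) : C :=
  Complex (expR (- Re alpha * t) * cos (Im alpha * t))
          (- (expR (- Re alpha * t) * sin (Im alpha * t))).

Definition cint d (T : measurableType d) (mu : {measure set T -> \bar R})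
    (D : set T) (f : T -> C) : C :=
  Complex (Rintegral mu D (fun x => Re (f x))) (Rintegral mu D (fun x => Im (f x))).

Definition csum (f : nat -> C) : C :=
  Complex (limn (series (fun n => Re (f n)))) (limn (series (fun n => Im (f n)))).
Definition ccvg (f : nat -> C) : Prop :=
  cvgn (series (fun n => Re (f n))) /\ cvgn (series (fun n => Im (f n))).

(* Rates: to (i+1,j), to (i,j+1), to (i-1,j) (used only if i>=1),    *)
(* to (i,j-1) (used only if j>=1).                                    *)
Record nnrates := NNRates {
  r_right : nat -> nat -> R;
  r_up    : nat -> nat -> R;
  r_left  : nat -> nat -> R;
  r_down  : nat -> nat -> R }.

Definition qtot (q : nnrates) (x : state) : R :=
  r_right q x.1 x.2 + r_up q x.1 x.2
  + (if (0 < x.1)%N then r_left q x.1 x.2 else 0)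
  + (if (0 < x.2)%N then r_down q x.1 x.2 else 0).

Definition qrate (q : nnrates) (x y : state) : R :=
  if y == (x.1.+1, x.2) then r_right q x.1 x.2
  else if y == (x.1, x.2.+1) then r_up q x.1 x.2
  else if (0 < x.1)%N && (y == (x.1.-1, x.2)) then r_left q x.1 x.2
  else if (0 < x.2)%N && (y == (x.1, x.2.-1)) then r_down q x.1 x.2
  else 0.

Definition pjump (q : nnrates) (x y : state) : R := qrate q x y / qtot q x.

Definition jtime d (T : measurableType d) (H : nat -> T -> R) (n : nat) (w : T) : R :=
  \sum_(k < n) H k w.

(* (Y, H) is the (minimal) CTMC with rates q started at z, given by its   *)
(* jump chain Y and holding times H: Y is a Markov chain with kernel      *)
(* pjump q started at z and, given Y, the H_k are independent             *)
(* exponential with parameters qtot q (Y_k).  This is expressed through  *)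
(* the finite-dimensional joint laws.                                     *)
Definition is_ctmc d (T : measurableType d) (P : probability T R) (q : nnrates)
    (z : state) (Y : nat -> T -> state) (H : nat -> T -> R) : Prop :=
  (forall n x, measurable (Y n @^-1` [set x])) /\
  (forall n, measurable_fun setT (H n)) /\
  (forall (n : nat) (ys : nat -> state) (ts : nat -> R),
     (forall k, 0 <= ts k) ->
     P [set w | forall k, (k <= n)%N -> Y k w = ys k /\ ts k < H k w] =
     ((ys 0%N == z)%:R * (\prod_(k < n) pjump q (ys k) (ys k.+1))
        * (\prod_(k < n.+1) expR (- qtot q (ys k) * ts k)))%:E).

Definition Xat d (T : measurableType d) (Y : nat -> T -> state) (H : nat -> T -> R)
    (t : R) (x : state) : set T :=
  [set w | exists n, Y n w = x /\ jtime H n w <= t < jtime H n.+1 w].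

(* The hitting time tau_A = inf{t>0 : X(t-) <> X(t) in A} equals J_n for  *)
(* the first n >= 1 with Y_n in A (the jump chain has no self-loops),     *)
(* and then X(tau_A) = Y_n.                                               *)
Definition first_hit d (T : measurableType d) (Y : nat -> T -> state)
    (A : set state) (n : nat) (w : T) : Prop :=
  (0 < n)%N /\ A (Y n w) /\ (forall k, (0 < k)%N -> (k < n)%N -> ~ A (Y k w)).

(* E[e^{-alpha tau_A} 1{X(tau_A) = y}] *)
Definition hitLT d (T : measurableType d) (P : probability T R)
    (Y : nat -> T -> state) (H : nat -> T -> R) (A : set state) (y : state)
    (alpha : C) : C :=
  cint P setT (fun w => csum (fun n =>
     toC (\1_[set w' | first_hit Y A n w' /\ Y n w' = y] w : R)
       * cexpn alpha (jtime H n w))).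

(* Event {t < tau_A, X(t) = x} *)
Definition Xbefore d (T : measurableType d) (Y : nat -> T -> state) (H : nat -> T -> R)
    (A : set state) (t : R) (x : state) : set T :=
  [set w | exists n, Y n w = x /\ jtime H n w <= t < jtime H n.+1 w /\
                     (forall k, (0 < k)%N -> (k <= n)%N -> ~ A (Y k w))].

Definition occLT d (T : measurableType d) (P : probability T R)
    (Y : nat -> T -> state) (H : nat -> T -> R) (A : set state) (x : state)
    (alpha : C) : C :=
  cint P setT (fun w =>
    cint (@lebesgue_measure R) `[0%R, +oo[
      (fun t => cexpn alpha t * toC (\1_(Xbefore Y H A t x) w : R))).

Definition piLT d (T : measurableType d) (P : probability T R)
    (Y : nat -> T -> state) (H : nat -> T -> R) (x : state) (alpha : C) : C :=
  cint (@lebesgue_measure R) `[0%R, +oo[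
    (fun t => cexpn alpha t * toC (fine (P (Xat Y H t x)))).

Definition model_rates (c : nat) (l1 l2 m1 m2 : R) : nnrates :=
  NNRates (fun _ _ => l1) (fun _ _ => l2)
          (fun i j => (minn i (c - j))%:R * m1)   (* = max(min(i,c-j),0) mu1 *)
          (fun i j => (minn c j)%:R * m2).

(* The M/M/1 queue (arrival la, service mu) run jointly with an independent *)
(* Poisson process of rate th: first coordinate = queue length, second =   *)
(* Poisson counter.                                                         *)
Definition mm1_poisson_rates (la mu th : R) : nnrates :=
  NNRates (fun _ _ => la) (fun _ _ => th) (fun _ _ => mu) (fun _ _ => 0).

Definition level (c i : nat) : set state := [set x | x.1 = i /\ (x.2 < c)%N].


Section Matrices.
Variables (d : measure_display) (T : measurableType d) (P : probability T R).
Variables (c : nat) (l1 l2 : R).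
(* the model chain started at each state z *)
Variables (Y : state -> nat -> T -> state) (H : state -> nat -> T -> R).
(* the M/M/1 queue (arr. l2, serv. c mu2) + Poisson(l1) chain started at (1,0) *)
Variables (Yb : nat -> T -> state) (Hb : nat -> T -> R).
Variable alpha : C.

Definition pivec (i : nat) : 'rV[C]_c :=
  \row_(j < c) piLT P (Y (0%N, 0%N)) (H (0%N, 0%N)) (i, nat_of_ord j) alpha.

Definition A1mx : 'M[C]_c := (toC l1)%:M.

Definition Gmx (i j : nat) : 'M[C]_c :=
  if i == j then 1%:M else
  \matrix_(k < c, l < c)
     hitLT P (Y (i, nat_of_ord k)) (H (i, nat_of_ord k)) (level c j) (j, nat_of_ord l) alpha.

Definition Nmx (i : nat) : 'M[C]_c :=
  \matrix_(k < c, l < c)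
     occLT P (Y (i, nat_of_ord k)) (H (i, nat_of_ord k)) (level c i.-1) (i, nat_of_ord l) alpha.

(* w^{lambda_2, c mu_2, lambda_1}_m(alpha) = E[e^{-alpha B} 1{Lambda(B) = m}], *)
(* B = first time the queue coordinate hits 0 from (1,0); Lambda(B) = the    *)
(* Poisson coordinate at that time.                                          *)
Definition wbusy (m : nat) : C :=
  hitLT P Yb Hb [set x | x.1 = 0%N] (0%N, m) alpha.

Definition Wmx (m : nat) : 'M[C]_c :=
  \matrix_(k < c, l < c)
     (if (nat_of_ord k == c.-1) && (nat_of_ord l == c.-1) then toC l2 * wbusy m else 0).

End Matrices.

End Defs.

(* Main.v *)
(* Put K(z, z') = q(z, z') / (q(z) + alpha). Conditioning on the jump chain and
   integrating out the exponential holding times turns every transform of the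
   statement into a sum of K-weights over taboo paths: a hitting transform is the
   weight of the paths that avoid the target set until they end in it, and an
   occupation transform at y is the weight of the taboo paths ending at y, divided
   by q(y) + alpha. Since the rates are bounded and Re alpha > 0, K contracts the
   sup norm, so bounded solutions of u = K u on a region, with zero data outside
   it, vanish; every identity between path sums is proved by this uniqueness.

   Split the paths from (0,0) to (i+1, l) at their last visit to L_0 U ... U L_i.
   The next jump leads either from (i, j) to (i+1, j), which gives the A_1 N_{i+1}
   term, or from (k, c-1) to (k, c). In the second case the phase stays >= c during
   a busy period of the M/M/1 queue (lambda_2, c mu_2), while the level grows as a
   Poisson process of rate lambda_1; the path comes back to phase c-1 at level
   k + m with weight w_m, and contributes only if k + m > i. From there it must
   enter L_{i+1} before L_i, because levels only decrease by one step from phases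
   < c, which gives G_{k+m,i+1} N_{i+1}. *)
Require Import Defs.
From HB Require Import structures.
From mathcomp Require Import all_boot all_order all_algebra.
From mathcomp Require Import all_classical all_reals all_analysis.
From mathcomp Require Import measurable_realfun complex.
From mathcomp Require Import zify ring lra.
Set Implicit Arguments. Unset Strict Implicit. Unset Printing Implicit Defensive.
Import Order.TTheory GRing.Theory Num.Theory.
Import numFieldNormedType.Exports.
Import Normc.
Local Open Scope classical_set_scope.
Local Open Scope ring_scope.

(** * Complex series *)

Section ComplexArith.
Variable R : realType.
Local Notation C := (R[i]).
Local Notation Re := complex.Re.
Local Notation Im := complex.Im.
Local Notation toC x := (Complex x 0).
Implicit Types (x y z : C) (f g : nat -> C).

(** [is_ctmc] prescribes only the probabilities of the events {Y_k = y_k, t_k < H_k for k <= n}, and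
    the chains started at different states come with no joint law. Instead of deriving a strong
    Markov property from this, every transform is reduced to a path sum, which depends on the rates
    and on the end points only. The weights K are complex, so positivity and monotone limits are of
    no help; this is why decompositions are verified as linear equations between bounded functions
    of the starting state. Two analytic points shape the rest. Sums and integrals are taken on real
    and imaginary parts and may take default values when they diverge, so convergence or
    integrability has to accompany each identity. And a bound on each single hitting weight would
    not make the series over l converge: what does is that the norms of the hitting weights of any
    finite set of targets add up to at most 1, whatever the size of the set. *)

Lemma cReD x y : Re (x + y) = Re x + Re y. Proof. by case: x y => [? ?] []. Qed.
Lemma cImD x y : Im (x + y) = Im x + Im y. Proof. by case: x y => [? ?] []. Qed.
Lemma cReM x y : Re (x * y) = Re x * Re y - Im x * Im y.
Proof. by case: x y => [? ?] []. Qed.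
Lemma cImM x y : Im (x * y) = Re x * Im y + Im x * Re y.
Proof. by case: x y => [? ?] []. Qed.
Lemma complex_ext x y : Re x = Re y -> Im x = Im y -> x = y.
Proof. by case: x y => [? ?] [? ?] /= -> ->. Qed.

Lemma toCM (a b : R) : toC (a * b) = toC a * toC b :> C.
Proof. by apply: complex_ext => /=; ring. Qed.
Lemma Re_sum (I : Type) (r : seq I) (P : pred I) (F : I -> C) :
  Re (\sum_(i <- r | P i) F i) = \sum_(i <- r | P i) Re (F i).
Proof. exact: (big_morph _ cReD). Qed.
Lemma Im_sum (I : Type) (r : seq I) (P : pred I) (F : I -> C) :
  Im (\sum_(i <- r | P i) F i) = \sum_(i <- r | P i) Im (F i).
Proof. exact: (big_morph _ cImD). Qed.

Lemma normc_ge0 x : 0 <= normc x. Proof. by case: x => a b; exact: sqrtr_ge0. Qed.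
Lemma normc_toC (a : R) : normc (toC a : C) = `|a|.
Proof. by rewrite /= expr0n addr0 sqrtr_sqr. Qed.
Lemma Re_le_normc x : `|Re x| <= normc x.
Proof.
by case: x => a b /=; rewrite -sqrtr_sqr ler_wsqrtr// lerDl sqr_ge0.
Qed.
Lemma Im_le_normc x : `|Im x| <= normc x.
Proof.
by case: x => a b /=; rewrite -[`|b|]sqrtr_sqr ler_wsqrtr// lerDr sqr_ge0.
Qed.
Lemma normc_le_ReIm x : normc x <= `|Re x| + `|Im x|.
Proof.
rewrite {1}(_ : x = toC (Re x) + Complex 0 (Im x)); last first.
  by case: x => a b; apply: complex_ext; rewrite /= ?addr0 ?add0r.
apply: le_trans (le_normcD _ _) _.
by rewrite normc_toC /= expr0n add0r sqrtr_sqr.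
Qed.
Lemma normc_sum (I : Type) (r : seq I) (F : I -> C) :
  normc (\sum_(i <- r) F i) <= \sum_(i <- r) normc (F i).
Proof.
elim: r => [|i r IH]; first by rewrite !big_nil normc0.
by rewrite !big_cons (le_trans (le_normcD _ _))// lerD2l.
Qed.

(** [csum] rests on [limn], which has a value even for a divergent series; the relation carries the
    convergence along with the value. *)
Definition has_csum f (s : C) : Prop :=
  series (fun n => Re (f n)) @ \oo --> Re s /\
  series (fun n => Im (f n)) @ \oo --> Im s.

Lemma has_csumE f s : has_csum f s -> csum f = s.
Proof.
case=> h1 h2; apply: complex_ext => /=;
  [exact: (cvg_lim (@Rhausdorff R) h1)|exact: (cvg_lim (@Rhausdorff R) h2)].
Qed.
Lemma has_csum_ccvg f s : has_csum f s -> ccvg f.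
Proof. by case=> h1 h2; split; [exact: cvgP h1|exact: cvgP h2]. Qed.
Lemma ccvg_csum f : ccvg f -> has_csum f (csum f).
Proof. by case. Qed.

Lemma has_csumD f g s t :
  has_csum f s -> has_csum g t -> has_csum (fun n => f n + g n) (s + t).
Proof.
move=> [f1 f2] [g1 g2]; split; rewrite ?cReD ?cImD.
  rewrite [X in X @ _](_ : _ = series (fun n => Re (f n)) \+ series (fun n => Re (g n))).
    exact: cvgD.
  by apply/funext => n; rewrite /series /= -big_split /=; under eq_bigr do rewrite cReD.
rewrite [X in X @ _](_ : _ = series (fun n => Im (f n)) \+ series (fun n => Im (g n))).
  exact: cvgD.
by apply/funext => n; rewrite /series /= -big_split /=; under eq_bigr do rewrite cImD.
Qed.

Lemma has_csumZ (a : C) f s : has_csum f s -> has_csum (fun n => a * f n) (a * s).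
Proof.
move=> [f1 f2]; split; rewrite ?cReM ?cImM.
  rewrite [X in X @ _](_ : _ = (fun n => Re a * series (fun n => Re (f n)) n
     - Im a * series (fun n => Im (f n)) n)).
    by apply: cvgB; apply: cvgM => //; exact: cvg_cst.
  apply/funext => n; rewrite /series /= !mulr_sumr -sumrB.
  by under eq_bigr do rewrite cReM.
rewrite [X in X @ _](_ : _ = (fun n => Re a * series (fun n => Im (f n)) n
   + Im a * series (fun n => Re (f n)) n)).
  by apply: cvgD; apply: cvgM => //; exact: cvg_cst.
apply/funext => n; rewrite /series /= !mulr_sumr -big_split /=.
by under eq_bigr do rewrite cImM.
Qed.

Lemma has_csum0 : has_csum (fun=> 0) 0.
Proof.
by split; rewrite [X in X @ _](_ : _ = fun=> 0); first [exact: cvg_cst|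
  apply/funext => n; rewrite /series /= big1].
Qed.

Lemma has_csum_sum (I : Type) (r : seq I) (F : I -> nat -> C) (S : I -> C) :
  (forall i, has_csum (F i) (S i)) ->
  has_csum (fun n => \sum_(i <- r) F i n) (\sum_(i <- r) S i).
Proof.
move=> FS; elim: r => [|i r IH].
  by rewrite big_nil; under eq_fun do rewrite big_nil; exact: has_csum0.
by rewrite big_cons; under eq_fun do rewrite big_cons; exact: has_csumD.
Qed.

Lemma has_csum_recl f s : has_csum (fun n => f n.+1) s <-> has_csum f (f 0%N + s).
Proof.
rewrite /has_csum cReD cImD.
have aux (h : nat -> R) (l : R) : (series (fun n => h n.+1) @ \oo --> l) <->
    (series h @ \oo --> h 0%N + l).
  have e : (fun n => series h n.+1) = (fun n => h 0%N + series (fun n => h n.+1) n).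
    by apply/funext => n; rewrite /series /= big_nat_recl.
  split=> H.
    by rewrite -cvg_shiftS e; apply: cvgD => //; exact: cvg_cst.
  move: H; rewrite -cvg_shiftS e => H.
  rewrite [X in X @ _](_ : _ = (fun n => - h 0%N + (h 0%N + series (fun n => h n.+1) n))).
    rewrite -[l](addKr (h 0%N)); apply: cvgD => //; exact: cvg_cst.
  by apply/funext => n; rewrite addKr.
by split=> -[h1 h2]; split; apply/(aux (fun n => _ (f n))).
Qed.

Lemma has_csum_shift f s N : (forall n, (n < N)%N -> f n = 0) ->
  has_csum f s <-> has_csum (fun n => f (n + N)%N) s.
Proof.
elim: N f => [|N IH] f f0; first by under [fun n => f (n + 0)%N]eq_fun do rewrite addn0.
have -> : s = f 0%N + s by rewrite f0// add0r.
rewrite -has_csum_recl IH => [|n nN]; last by rewrite f0.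
by under [X in _ <-> has_csum X _]eq_fun do rewrite addnS; rewrite f0// add0r.
Qed.

Lemma abs_ccvg f (M : R) : (forall n, \sum_(k < n) normc (f k) <= M) -> ccvg f.
Proof.
move=> fM; have cn : cvgn (series (fun n => normc (f n))).
  apply: nondecreasing_is_cvgn.
    apply/nondecreasing_seqP => n; rewrite /series /= big_nat_recr//= lerDl.
    exact: normc_ge0.
  by exists M => _ [n _ <-]; rewrite /series /= big_mkord.
split; apply: normed_cvg; apply: (series_le_cvg _ _ _ cn) => n //=;
  rewrite ?normc_ge0// ?Re_le_normc ?Im_le_normc//.
Qed.

(** The factor 2 comes from bounding real and imaginary parts separately. It is harmless, since the
    uniqueness argument needs some bound and not a sharp one. *)
Lemma csum_bound f (M : R) : (forall n, \sum_(k < n) normc (f k) <= M) ->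
  normc (csum f) <= M + M.
Proof.
move=> fM; have [c1 c2] := abs_ccvg fM.
have aux (h : nat -> R) : (forall n, `|h n| <= normc (f n)) -> cvgn (series h) ->
    `|limn (series h)| <= M.
  move=> hf ch; have H : `|series h n| @[n --> \oo] --> `|limn (series h)| by apply: cvg_norm.
  rewrite -(cvg_lim (@Rhausdorff R) H); apply: limr_le; first exact: cvgP H.
  apply: nearW => n; apply: le_trans (fM n); rewrite /series /= big_mkord.
  by apply: le_trans (ler_norm_sum _ _ _) _; apply: ler_sum.
apply: le_trans (normc_le_ReIm _) _; apply: lerD; apply: aux => // n.
  exact: Re_le_normc.
exact: Im_le_normc.
Qed.

End ComplexArith.

(** * Weighted sums over taboo paths *)

(** A finite list without repetition that holds every state reached by a jump, so that the kernel
    acts through finite sums. The guards keep the truncated predecessor of 0 from making a state its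
    own neighbour. *)
Definition nb (z : state) : seq state :=
  [:: (z.1.+1, z.2); (z.1, z.2.+1)]
  ++ (if (0 < z.1)%N then [:: (z.1.-1, z.2)] else [::])
  ++ (if (0 < z.2)%N then [:: (z.1, z.2.-1)] else [::]).

Lemma nb_uniq z : uniq (nb z).
Proof.
case: z => [[|i] [|j]]; rewrite /nb /= ?inE ?xpair_eqE //=; lia.
Qed.

Section Kernel.
Variables (R : realType) (q : nnrates R) (alpha : R[i]).
Local Notation C := (R[i]).
Local Notation Re := complex.Re.
Local Notation toC x := (Complex x 0).
Implicit Types (z y : state) (f : state -> C) (A : pred state).

Lemma qrate_right z : qrate q z (z.1.+1, z.2) = r_right q z.1 z.2.
Proof. by rewrite /qrate eqxx. Qed.
Lemma qrate_up z : qrate q z (z.1, z.2.+1) = r_up q z.1 z.2.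
Proof. by rewrite /qrate eqxx xpair_eqE ltn_eqF. Qed.
Lemma qrate_left z : (0 < z.1)%N -> qrate q z (z.1.-1, z.2) = r_left q z.1 z.2.
Proof.
case: z => [[|i] j] //= _; rewrite /qrate /= !xpair_eqE !eqxx ltn_eqF; last by lia.
by rewrite ltn_eqF.
Qed.
Lemma qrate_down z : (0 < z.2)%N -> qrate q z (z.1, z.2.-1) = r_down q z.1 z.2.
Proof.
case: z => [i [|j]] //= _; rewrite /qrate /= !xpair_eqE !eqxx !andbT /=.
rewrite ltn_eqF//= (_ : (j == j.+2) = false); last by lia.
by case: i => [|i] //=; rewrite gtn_eqF.
Qed.

Lemma sum_nb (V : nmodType) (F : state -> V) z : \sum_(y <- nb z) F y =
  F (z.1.+1, z.2) + F (z.1, z.2.+1) + (if (0 < z.1)%N then F (z.1.-1, z.2) else 0)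
  + (if (0 < z.2)%N then F (z.1, z.2.-1) else 0).
Proof.
rewrite /nb !big_cat /= !big_cons big_nil addr0 !addrA; congr (_ + _ + _).
  by case: ifP => _; rewrite ?big_seq1 ?big_nil.
by case: ifP => _; rewrite ?big_seq1 ?big_nil.
Qed.

Lemma qtot_nb z : qtot q z = \sum_(y <- nb z) qrate q z y.
Proof.
rewrite sum_nb qrate_right qrate_up /qtot; congr (_ + _ + _).
  by case: ifP => // /qrate_left.
by case: ifP => // /qrate_down.
Qed.

Definition kden z : C := toC (qtot q z) + alpha.
(** This is [pjump q z y] times [qtot q z / (qtot q z + alpha)], the Laplace transform of the
    exponential holding time in [z]. *)
Definition kernel z y : C := toC (qrate q z y) / kden z.
Definition kop f z : C := \sum_(y <- nb z) kernel z y * f y.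

Lemma eq_kop f g z : (forall y, y \in nb z -> f y = g y) -> kop f z = kop g z.
Proof. by move=> fg; apply: eq_big_seq => y yz; rewrite fg. Qed.

Lemma kopD f g z : kop (fun y => f y + g y) z = kop f z + kop g z.
Proof. by rewrite /kop -big_split; apply: eq_bigr => y _; rewrite mulrDr. Qed.
Lemma kopZ a f z : kop (fun y => a * f y) z = a * kop f z.
Proof. by rewrite /kop mulr_sumr; apply: eq_bigr => y _; rewrite mulrCA. Qed.
Lemma kop_sum (I : Type) (r : seq I) (F : I -> state -> C) z :
  kop (fun y => \sum_(i <- r) F i y) z = \sum_(i <- r) kop (F i) z.
Proof.
by rewrite /kop exchange_big; apply: eq_bigr => y _; rewrite mulr_sumr.
Qed.
Lemma kopB f g z : kop (fun y => f y - g y) z = kop f z - kop g z.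
Proof. by rewrite /kop -sumrB; apply: eq_bigr => y _; rewrite mulrBr. Qed.

Lemma has_csum_kop (F : nat -> state -> C) f z :
  (forall y, has_csum (fun n => F n y) (f y)) ->
  has_csum (fun n => kop (F n) z) (kop f z).
Proof.
move=> Ff; rewrite /kop.
by apply: has_csum_sum => y; apply: has_csumZ.
Qed.

Lemma kopE f z : kop f z = (toC (r_right q z.1 z.2) * f (z.1.+1, z.2)
  + toC (r_up q z.1 z.2) * f (z.1, z.2.+1)
  + (if (0 < z.1)%N then toC (r_left q z.1 z.2) * f (z.1.-1, z.2) else 0)
  + (if (0 < z.2)%N then toC (r_down q z.1 z.2) * f (z.1, z.2.-1) else 0)) / kden z.
Proof.
rewrite /kop sum_nb /kernel qrate_right qrate_up !mulrDl; congr (_ + _ + _ + _).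
- by rewrite mulrAC.
- by rewrite mulrAC.
- by case: ifP => [/qrate_left ->|_]; rewrite ?mul0r// mulrAC.
- by case: ifP => [/qrate_down ->|_]; rewrite ?mul0r// mulrAC.
Qed.

Variable Q : R.
Hypothesis q_ge0 : forall z y, 0 <= qrate q z y.
Hypothesis q_gt0 : forall z, 0 < qtot q z.
Hypothesis q_le : forall z, qtot q z <= Q.
Hypothesis alpha_gt0 : 0 < Re alpha.

(** As t / (t + Re alpha) increases with t, the bound [Q] on the total rates turns into a uniform
    bound on the row sums of the norms of [kernel]. *)
Definition kratio : R := Q / (Q + Re alpha).

Let Q_gt0 : 0 < Q := lt_le_trans (q_gt0 (0%N, 0%N)) (q_le _).

Lemma kratio_ge0 : 0 <= kratio.
Proof. by rewrite divr_ge0 ?addr_ge0 // ltW. Qed.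
Lemma kratio_lt1 : kratio < 1.
Proof. by rewrite /kratio ltr_pdivrMr ?mul1r ?ltrDl// addr_gt0. Qed.

Lemma kden_ge z : qtot q z + Re alpha <= normc (kden z).
Proof.
apply: le_trans (Re_le_normc _); rewrite /kden cReD /=; exact: ler_norm.
Qed.
Lemma kden_gt0 z : 0 < normc (kden z).
Proof. by apply: lt_le_trans (kden_ge z); rewrite addr_gt0. Qed.
Lemma kden_neq0 z : kden z != 0.
Proof. by apply/eqP => k0; have := kden_gt0 z; rewrite k0 normc0 ltxx. Qed.

Lemma qtot_kden z : qtot q z / normc (kden z) <= kratio.
Proof.
apply: (@le_trans _ _ (qtot q z / (qtot q z + Re alpha))).
  rewrite ler_wpM2l ?(ltW (q_gt0 z))// lef_pV2 ?kden_ge// posrE ?kden_gt0//.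
  exact: addr_gt0.
rewrite /kratio ler_pdivrMr; last exact: addr_gt0.
rewrite mulrAC ler_pdivlMr; last exact: addr_gt0.
have h : 0 <= (Q - qtot q z) * Re alpha by rewrite mulr_ge0 ?subr_ge0// ltW.
by lra.
Qed.

(** The contraction is stated for finite families, with the sum of the norms of the members in place
    of a single norm; this form gives the summability of hitting weights over many targets. *)
Lemma kop_sum_le (I : Type) (r : seq I) (F : I -> state -> C) B z : 0 <= B ->
  (forall y, \sum_(i <- r) normc (F i y) <= B) ->
  \sum_(i <- r) normc (kop (F i) z) <= kratio * B.
Proof.
move=> B0 FB.
apply: (@le_trans _ _ (\sum_(i <- r) \sum_(y <- nb z) normc (kernel z y) * normc (F i y))).
  apply: ler_sum => i _; apply: le_trans (normc_sum _ _) _.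
  by apply: ler_sum => y _; rewrite normcM.
rewrite exchange_big /=.
apply: (@le_trans _ _ (\sum_(y <- nb z) normc (kernel z y) * B)).
  by apply: ler_sum => y _; rewrite -mulr_sumr ler_wpM2l ?normc_ge0.
rewrite -mulr_suml ler_wpM2r//; apply: le_trans (qtot_kden z).
rewrite qtot_nb mulr_suml; apply: ler_sum => y _.
by rewrite /kernel normcM normc_toC ger0_norm ?q_ge0// normcV.
Qed.

Lemma kop_le f B z : 0 <= B -> (forall y, normc (f y) <= B) ->
  normc (kop f z) <= kratio * B.
Proof.
move=> B0 fB; have := @kop_sum_le nat [:: 0%N] (fun=> f) B z B0.
by rewrite big_seq1; apply => y; rewrite big_seq1.
Qed.

Lemma kratio_limit (a b c : R) : (forall n, a <= b + kratio ^+ n * c) -> a <= b.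
Proof.
move=> h; have : (fun n => b + kratio ^+ n * c) @ \oo --> b.
  rewrite -[X in _ --> X]addr0 -[X in _ + X](mul0r c).
  apply: cvgD; first exact: cvg_cst.
  apply: cvgM; last exact: cvg_cst.
  by apply: cvg_expr; rewrite ger0_norm ?kratio_ge0// kratio_lt1.
move=> H; rewrite -(cvg_lim (@Rhausdorff R) H); apply: limr_ge; first exact: cvgP H.
by apply: nearW => n; exact: h.
Qed.

(** Each use of the equation gains a factor [kratio] in the bound, so the norm of [f] is at most
    [kratio ^+ n * B] for every [n]. The alternative is chosen state by state: a function set to 0
    outside a region has to satisfy the equation only inside it. *)
Lemma kop_fix0 f B : (forall z, normc (f z) <= B) ->
  (forall z, f z = 0 \/ f z = kop f z) -> forall z, f z = 0.
Proof.
move=> fB fE z; apply: eq0_normc; apply/eqP; rewrite eq_le normc_ge0 andbT.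
have B0 : 0 <= B := le_trans (normc_ge0 _) (fB (0%N, 0%N)).
apply: (@kratio_limit _ _ B) => n; rewrite add0r; elim: n z => [|n IH] z.
  by rewrite mul1r.
case: (fE z) => ->.
  by rewrite normc0 mulr_ge0// exprn_ge0// kratio_ge0.
by rewrite exprS -mulrA; apply: kop_le IH; rewrite mulr_ge0// exprn_ge0// kratio_ge0.
Qed.

(* Total K-weight of the n-step paths from z to y whose vertices at steps
   1, ..., n-1 lie in A; the end points are unconstrained. *)
Fixpoint tab A y n z : C :=
  if n is n'.+1 then kop (fun z' => if (n' == 0%N) || A z' then tab A y n' z' else 0) z
  else (z == y)%:R.

Lemma tab_le A y n z : normc (tab A y n z) <= kratio ^+ n.
Proof.
elim: n z => [|n IH] z /=.
  by case: eqP => _; rewrite ?normc1 ?normc0.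
rewrite exprS; apply: kop_le => [|z']; first by rewrite exprn_ge0// kratio_ge0.
by case: ifP => _ //; rewrite normc0 exprn_ge0// kratio_ge0.
Qed.

Lemma sum_kratio n m : \sum_(k < n) kratio ^+ (k + m) <= (1 - kratio)^-1.
Proof.
have k1 : 0 < 1 - kratio by rewrite subr_gt0 kratio_lt1.
rewrite -[X in _ <= X]mul1r ler_pdivlMr//.
apply: (@le_trans _ _ ((\sum_(k < n) kratio ^+ k) * (1 - kratio))).
  rewrite ler_wpM2r ?(ltW k1)//; apply: ler_sum => k _; rewrite exprD.
  rewrite ler_piMr ?exprn_ge0 ?kratio_ge0// exprn_ile1 ?kratio_ge0// ltW//.
  exact: kratio_lt1.
by rewrite mulrC -opprB mulNr -subrX1 opprB gerBl exprn_ge0// kratio_ge0.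
Qed.

Definition green A y z : C := csum (fun n => tab A y n z).
(** Lengths start at 1 because a hitting time only counts states entered by a jump; starting in the
    target is no hit. *)
Definition hits A y z : C := csum (fun n => tab A y n.+1 z).

Let Kbd : R := (1 - kratio)^-1 + (1 - kratio)^-1.

Lemma has_csum_green A y z : has_csum (fun n => tab A y n z) (green A y z).
Proof.
apply: ccvg_csum; apply: (@abs_ccvg _ _ (1 - kratio)^-1) => n.
apply: le_trans (sum_kratio n 0); apply: ler_sum => k _; rewrite addn0; exact: tab_le.
Qed.
Lemma has_csum_hits A y z : has_csum (fun n => tab A y n.+1 z) (hits A y z).
Proof.
apply: ccvg_csum; apply: (@abs_ccvg _ _ (1 - kratio)^-1) => n.
apply: le_trans (sum_kratio n 1); apply: ler_sum => k _; rewrite addn1; exact: tab_le.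
Qed.
Lemma green_bounded : exists B, forall A y z, normc (green A y z) <= B.
Proof.
exists Kbd => A y z; apply: csum_bound => n.
apply: le_trans (sum_kratio n 0); apply: ler_sum => k _; rewrite addn0; exact: tab_le.
Qed.
Lemma hits_bounded : exists B, forall A y z, normc (hits A y z) <= B.
Proof.
exists Kbd => A y z; apply: csum_bound => n.
apply: le_trans (sum_kratio n 1); apply: ler_sum => k _; rewrite addn1; exact: tab_le.
Qed.

(** First-step equation. In [tab] the last vertex is exempt from the taboo; with [y] in [A] the
    exemption has no effect, since a path of length 0 from z' has weight only when z' = y. *)
Lemma green_eq A y z : A y ->
  green A y z = (z == y)%:R + kop (fun z' => if A z' then green A y z' else 0) z.
Proof.
move=> Ay; apply: has_csumE.
apply/(has_csum_recl (fun n => tab A y n z)) => /=.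
have -> : (fun n => kop (fun z' => if (n == 0%N) || A z' then tab A y n z' else 0) z) =
   (fun n => kop (fun z' => if A z' then tab A y n z' else 0) z).
  apply/funext => -[|n] //=; apply: eq_kop => z' _.
  by case: eqP => [->|]; rewrite ?Ay//; case: ifP.
apply: has_csum_kop => z'; case: ifP => _; last exact: has_csum0.
exact: has_csum_green.
Qed.

(** First-step equation. As [y] lies outside [A], paths that stop after one step and paths that go
    on have their first vertex on opposite sides of [A], so one conditional covers both. *)
Lemma hits_eq A y z : ~~ A y ->
  hits A y z = kop (fun z' => if A z' then hits A y z' else (z' == y)%:R) z.
Proof.
move=> Ay; apply: has_csumE.
rewrite (_ : kop _ z = tab A y 1 z
   + kop (fun z' => if A z' then hits A y z' else 0) z); last first.
  rewrite /= -kopD; apply: eq_kop => z' _ /=.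
  by case: eqP => [->|_]; rewrite ?(negbTE Ay) ?addr0 ?add0r.
apply/(has_csum_recl (fun n => tab A y n.+1 z)) => /=.
apply: has_csum_kop => z'; case: ifP => _; last exact: has_csum0.
exact: has_csum_hits.
Qed.

End Kernel.

(** * Integrals of complex-valued functions *)

Section ComplexIntegral.
Context d (T : measurableType d) (R : realType).
Local Notation C := (R[i]).
Local Notation Re := complex.Re.
Local Notation Im := complex.Im.
Local Notation toC x := (Complex x 0).
Variable mu : {measure set T -> \bar R}.
Implicit Types (D : set T) (f g : T -> C).

Definition cmeas D f := measurable_fun D (fun x => Re (f x)) /\
  measurable_fun D (fun x => Im (f x)).
Definition cintegrable D f := mu.-integrable D (EFin \o (fun x => Re (f x))) /\
  mu.-integrable D (EFin \o (fun x => Im (f x))).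

Lemma cmeasD D f g : cmeas D f -> cmeas D g -> cmeas D (fun x => f x + g x).
Proof.
move=> [f1 f2] [g1 g2]; split.
  by under eq_fun do rewrite cReD; exact: measurable_funD.
by under eq_fun do rewrite cImD; exact: measurable_funD.
Qed.
Lemma cmeasM D f g : cmeas D f -> cmeas D g -> cmeas D (fun x => f x * g x).
Proof.
move=> [f1 f2] [g1 g2]; split.
  by under eq_fun do rewrite cReM; apply: measurable_funB; exact: measurable_funM.
by under eq_fun do rewrite cImM; apply: measurable_funD; exact: measurable_funM.
Qed.
Lemma cmeas_cst D (c : C) : cmeas D (fun=> c).
Proof. by split; exact: measurable_cst. Qed.
Lemma cmeas_toC D (h : T -> R) : measurable_fun D h -> cmeas D (fun x => toC (h x)).
Proof. by move=> mh; split => //=; exact: measurable_cst. Qed.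
Lemma cmeas_sum D (I : Type) (r : seq I) (F : I -> T -> C) :
  (forall i, cmeas D (F i)) -> cmeas D (fun x => \sum_(i <- r) F i x).
Proof.
move=> mF; elim: r => [|i r IH].
  by under eq_fun do rewrite big_nil; exact: cmeas_cst.
by under eq_fun do rewrite big_cons; exact: cmeasD.
Qed.

Lemma cintegrable_cmeas D f : cintegrable D f -> cmeas D f.
Proof.
by move=> [/measurable_int/measurable_EFinP ? /measurable_int/measurable_EFinP ?].
Qed.

Lemma cintegrable_le D f (g : T -> R) : measurable D -> cmeas D f ->
  mu.-integrable D (EFin \o g) -> (forall x, D x -> normc (f x) <= g x) ->
  cintegrable D f.
Proof.
move=> mD [m1 m2] ig fg; split; apply: (le_integrable mD _ _ ig).
- exact/measurable_EFinP.
- move=> x Dx /=; rewrite lee_fin; apply: le_trans (Re_le_normc _) _.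
  exact: le_trans (fg _ Dx) (ler_norm _).
- exact/measurable_EFinP.
- move=> x Dx /=; rewrite lee_fin; apply: le_trans (Im_le_normc _) _.
  exact: le_trans (fg _ Dx) (ler_norm _).
Qed.

Lemma cintegrableZ D (a : C) f : measurable D -> cintegrable D f ->
  cintegrable D (fun x => a * f x).
Proof.
move=> mD [f1 f2]; split.
  rewrite (_ : EFin \o _ = (fun x => (Re a)%:E * (EFin \o (fun x => Re (f x))) x -
     (Im a)%:E * (EFin \o (fun x => Im (f x))) x)%E).
    by apply: integrableB => //; apply: integrableZl.
  by apply/funext => x /=; rewrite cReM.
rewrite (_ : EFin \o _ = (fun x => (Re a)%:E * (EFin \o (fun x => Im (f x))) x +
   (Im a)%:E * (EFin \o (fun x => Re (f x))) x)%E).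
  by apply: integrableD => //; apply: integrableZl.
by apply/funext => x /=; rewrite cImM.
Qed.

Lemma cintegrableD D f g : measurable D -> cintegrable D f -> cintegrable D g ->
  cintegrable D (fun x => f x + g x).
Proof.
move=> mD [f1 f2] [g1 g2]; split.
  rewrite (_ : EFin \o _ = (EFin \o (fun x => Re (f x))) \+ (EFin \o (fun x => Re (g x))))%E.
    exact: integrableD.
  by apply/funext => x /=; rewrite cReD.
rewrite (_ : EFin \o _ = (EFin \o (fun x => Im (f x))) \+ (EFin \o (fun x => Im (g x))))%E.
  exact: integrableD.
by apply/funext => x /=; rewrite cImD.
Qed.

Lemma cintZ D (a : C) f : measurable D -> cintegrable D f ->
  cint mu D (fun x => a * f x) = a * cint mu D f.
Proof.
move=> mD [f1 f2]; apply: complex_ext; rewrite ?cReM ?cImM /=.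
  rewrite -!RintegralZl// -RintegralB//.
  - by congr Rintegral; apply/funext => x; rewrite cReM.
  - exact: (integrableZl mD (Re a) f1).
  - exact: (integrableZl mD (Im a) f2).
rewrite -!RintegralZl// -RintegralD//.
- by congr Rintegral; apply/funext => x; rewrite cImM.
- exact: (integrableZl mD (Re a) f2).
- exact: (integrableZl mD (Im a) f1).
Qed.

Lemma cintD D f g : measurable D -> cintegrable D f -> cintegrable D g ->
  cint mu D (fun x => f x + g x) = cint mu D f + cint mu D g.
Proof.
move=> mD [f1 f2] [g1 g2]; apply: complex_ext; rewrite ?cReD ?cImD /= -RintegralD//.
  by congr Rintegral; apply/funext => x; rewrite cReD.
by congr Rintegral; apply/funext => x; rewrite cImD.
Qed.

Lemma eq_cint D f g : (forall x, D x -> f x = g x) -> cint mu D f = cint mu D g.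
Proof.
by move=> fg; congr Complex; apply: eq_Rintegral => x /set_mem Dx; rewrite fg.
Qed.

Lemma cint_sum D (I : Type) (r : seq I) (F : I -> T -> C) : measurable D ->
  (forall i, cintegrable D (F i)) ->
  cintegrable D (fun x => \sum_(i <- r) F i x) /\
  cint mu D (fun x => \sum_(i <- r) F i x) = \sum_(i <- r) cint mu D (F i).
Proof.
move=> mD iF; elim: r => [|i r [IH1 IH2]].
  rewrite big_nil; under eq_fun do rewrite big_nil; split.
    by split; exact: integrable0.
  by apply: complex_ext => /=; rewrite /Rintegral integral0.
rewrite big_cons; under eq_fun do rewrite big_cons; split; first exact: cintegrableD.
by rewrite cintD// IH2.
Qed.

Lemma ae_eq_cint D f g : measurable D -> cmeas D f -> cmeas D g ->
  (\forall x \ae mu, D x -> f x = g x) -> cint mu D f = cint mu D g.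
Proof.
move=> mD [f1 f2] [g1 g2] fg; congr Complex; congr fine; apply: ae_eq_integral => //.
- exact/measurable_EFinP.
- exact/measurable_EFinP.
- by apply: filterS fg => x h Dx; rewrite h.
- exact/measurable_EFinP.
- exact/measurable_EFinP.
- by apply: filterS fg => x h Dx; rewrite h.
Qed.

Lemma cmeas_csum D (F : nat -> T -> C) f : (forall n, cmeas D (F n)) ->
  (forall x, D x -> has_csum (F ^~ x) (f x)) -> cmeas D f.
Proof.
move=> mF Ff; split.
  apply: (@measurable_fun_cvg _ _ _ _ (fun n x => series (fun n => Re (F n x)) n)).
    by move=> m; apply: measurable_sum => k; exact: (mF k).1.
  by move=> x Dx; exact: (Ff x Dx).1.
apply: (@measurable_fun_cvg _ _ _ _ (fun n x => series (fun n => Im (F n x)) n)).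
  by move=> m; apply: measurable_sum => k; exact: (mF k).2.
by move=> x Dx; exact: (Ff x Dx).2.
Qed.

Lemma Rintegral_cvg D (F : nat -> T -> R) (f g : T -> R) : measurable D ->
  (forall n, measurable_fun D (F n)) ->
  (forall x, D x -> F ^~ x @ \oo --> f x) ->
  mu.-integrable D (EFin \o g) ->
  (forall n x, D x -> `|F n x| <= g x) ->
  (fun n => Rintegral mu D (F n)) @ \oo --> Rintegral mu D f.
Proof.
move=> mD mF Ff ig Fg.
have mf : measurable_fun D f by apply: measurable_fun_cvg mF Ff.
have Ff' x : D x -> (EFin \o F n) x @[n --> \oo] --> (EFin \o f) x.
  by move=> Dx; apply: cvg_EFin; [exact: nearW|exact: Ff].
have [i1 _ h] := @dominated_convergence _ T R mu D mD (fun n => EFin \o F n) (EFin \o f)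
  (EFin \o g) (fun n => (measurable_EFinP _ _).2 (mF n)) ((measurable_EFinP _ _).2 mf)
  (aeW _ Ff') ig
  (aeW _ (fun x n Dx => Fg n x Dx)).
apply: fine_cvg; rewrite fineK; last exact: integrable_fin_num.
exact: h.
Qed.

(** Domination is asked of the partial sums and not of the sum of the norms: in the applications at
    most one summand is nonzero at each point, which bounds every partial sum by that summand. *)
Lemma cint_csum D (F : nat -> T -> C) f (g : T -> R) : measurable D ->
  (forall n, cmeas D (F n)) ->
  mu.-integrable D (EFin \o g) ->
  (forall n x, D x -> normc (\sum_(k < n) F k x) <= g x) ->
  (forall x, D x -> has_csum (F ^~ x) (f x)) ->
  has_csum (fun n => cint mu D (F n)) (cint mu D f).
Proof.
move=> mD mF ig Fg Ff.
have iS n : cintegrable D (fun x => \sum_(k < n) F k x).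
  by apply: (cintegrable_le mD _ ig (Fg n)); exact: cmeas_sum.
have iF n : cintegrable D (F n).
  (* Each term is the difference of two consecutive partial sums, which are integrable by
     domination. *)
  rewrite (_ : F n = fun x => \sum_(k < n.+1) F k x + (-1) * \sum_(k < n) F k x).
    by apply: cintegrableD => //; exact: cintegrableZ.
  by apply/funext => x; rewrite big_ord_recr /= mulN1r addrAC subrr add0r.
have e n : \sum_(k < n) cint mu D (F k) = cint mu D (fun x => \sum_(k < n) F k x).
  by rewrite (cint_sum (index_enum 'I_n) mD (fun i : 'I_n => iF i)).2.
split.
  rewrite [X in X @ _](_ : _ = fun n => Rintegral mu D (fun x => Re (\sum_(k < n) F k x))).
    apply: (Rintegral_cvg mD (fun n => (cintegrable_cmeas (iS n)).1) _ ig) => [x Dx|n x Dx].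
      rewrite (_ : (fun n => _) = series (fun n => Re (F n x))); first exact: (Ff x Dx).1.
      by apply/funext => n; rewrite Re_sum /series /= big_mkord.
    exact: le_trans (Re_le_normc _) (Fg _ _ Dx).
  apply/funext => n; rewrite /series /= big_mkord.
  by have := congr1 (@complex.Re R) (e n); rewrite Re_sum /= => <-.
rewrite [X in X @ _](_ : _ = fun n => Rintegral mu D (fun x => Im (\sum_(k < n) F k x))).
  apply: (Rintegral_cvg mD (fun n => (cintegrable_cmeas (iS n)).2) _ ig) => [x Dx|n x Dx].
    rewrite (_ : (fun n => _) = series (fun n => Im (F n x))); first exact: (Ff x Dx).2.
    by apply/funext => n; rewrite Im_sum /series /= big_mkord.
  exact: le_trans (Im_le_normc _) (Fg _ _ Dx).
apply/funext => n; rewrite /series /= big_mkord.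
by have := congr1 (@complex.Im R) (e n); rewrite Im_sum /= => <-.
Qed.

End ComplexIntegral.

Lemma measurable_set_lt d (T : measurableType d) (R : realType) (f g : T -> R) :
  measurable_fun setT f -> measurable_fun setT g -> measurable [set x | f x < g x].
Proof.
move=> mf mg; have := measurable_fun_ltr mf mg measurableT (Y := [set true]) I.
by rewrite setTI.
Qed.

Lemma measurable_set_le d (T : measurableType d) (R : realType) (f g : T -> R) :
  measurable_fun setT f -> measurable_fun setT g -> measurable [set x | f x <= g x].
Proof.
move=> mf mg; have := measurable_fun_ler mf mg measurableT (Y := [set true]) I.
by rewrite setTI.
Qed.

Lemma mul_toC_bool (R : realType) (z : R[i]) (b : bool) :
  z * Complex b%:R 0 = if b then z else 0.
Proof. by case: b; [exact: mulr1|exact: mulr0]. Qed.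

(** * Laplace integrals of the complex exponential *)

Section Exponential.
Variable R : realType.
Local Notation C := (R[i]).
Local Notation Re := complex.Re.
Local Notation Im := complex.Im.
Local Notation toC x := (Complex x 0).
Local Notation leb := (@lebesgue_measure R).
Local Notation RM := (measurableTypeR R).
Local Notation half := (`[0%R, +oo[%classic : set RM).
Implicit Types alpha : C.

Lemma normc_cexpn alpha t : normc (cexpn alpha t) = expR (- Re alpha * t).
Proof.
rewrite /cexpn /= sqrrN !exprMn -mulrDr cos2Dsin2 mulr1 sqrtr_sqr.
by rewrite ger0_norm// expR_ge0.
Qed.
Lemma normc_cexpn_le1 alpha t : 0 <= Re alpha -> 0 <= t -> normc (cexpn alpha t) <= 1.
Proof.
move=> a0 t0; rewrite normc_cexpn -expR0 ler_expR mulNr oppr_le0 mulr_ge0//.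
Qed.
Lemma cexpn0 alpha : cexpn alpha 0 = 1.
Proof.
by rewrite /cexpn !mulr0 expR0 cos0 sin0 mulr0 oppr0 mul1r.
Qed.
Lemma cexpnD alpha s t : cexpn alpha (s + t) = cexpn alpha s * cexpn alpha t.
Proof.
apply: complex_ext; rewrite /cexpn ?cReM ?cImM /= !mulrDr expRD ?cosD ?sinD; ring.
Qed.
(** Discounting an exponential tail of rate [q] shifts [alpha] to [q + alpha]; the denominators
    [kden] originate here. *)
Lemma cexpnDl alpha (q t : R) :
  cexpn alpha t * toC (expR (- q * t)) = cexpn (toC q + alpha) t.
Proof.
apply: complex_ext; rewrite /cexpn ?cReM ?cImM /= ?cReD ?cImD /= add0r;
  rewrite opprD mulrDl expRD; ring.
Qed.

Lemma cmeas_cexpn alpha d (T : measurableType d) (D : set T) (h : T -> R) :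
  measurable_fun D h -> cmeas D (fun x => cexpn alpha (h x)).
Proof.
move=> mh.
have mE : measurable_fun D (fun x => expR (- Re alpha * h x)).
  by apply: measurableT_comp => //; exact: measurable_funM.
have mI : measurable_fun D (fun x => Im alpha * h x) by exact: measurable_funM.
split => /=.
  apply: measurable_funM => //; apply: (measurableT_comp _ mI).
  by apply: continuous_measurable_fun; exact: continuous_cos.
apply: measurableT_comp => //.
apply: measurable_funM => //; apply: (measurableT_comp _ mI).
by apply: continuous_measurable_fun; exact: continuous_sin.
Qed.

Lemma integrable_expR_half (a : R) : 0 < a ->
  leb.-integrable half (EFin \o (fun t => expR (- a * t))).
Proof.
move=> a0.
have h : leb.-integrable half (EFin \o exponential_pdf a).
  exact: integrableS (integrable_exponential_pdf a0).
have h2 : leb.-integrable half (fun x => a^-1%:E * (EFin \o exponential_pdf a) x)%E.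
  exact: integrableZl.
apply: eq_integrable h2 => // t /set_mem /=; rewrite in_itv/= andbT => t0.
by rewrite exponential_pdfE// -EFinM mulrA mulVf ?gt_eqF// mul1r.
Qed.

Lemma cintegrable_cexpn alpha : 0 < Re alpha -> cintegrable leb half (cexpn alpha).
Proof.
move=> a0; apply: cintegrable_le (integrable_expR_half a0) _ => //.
  exact: cmeas_cexpn.
by move=> t _; rewrite normc_cexpn.
Qed.

Lemma cint_cexpn_itv alpha s t : 0 < Re alpha -> s <= t ->
  cint leb `[s, t[ (cexpn alpha) = (cexpn alpha s - cexpn alpha t) / alpha.
Proof.
move=> a0; rewrite le_eqVlt => /predU1P[->|st].
  rewrite subrr mul0r set_itvco0 /cint !Rintegral_set0//.
set a := Re alpha; set b := Im alpha.
have ab0 : a ^+ 2 + b ^+ 2 != 0.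
  by rewrite gt_eqF// ltr_pwDl ?exprn_gt0// sqr_ge0.
have al0 : alpha != 0 by apply/eqP => h; move: a0; rewrite h ltxx.
(* [F] and [G] are the real and imaginary parts of the primitive - exp(- alpha x) / alpha of exp(-
   alpha x). *)
pose F (x : R) := expR (- a * x) * (b * sin (b * x) - a * cos (b * x)) / (a ^+ 2 + b ^+ 2).
pose G (x : R) := expR (- a * x) * (a * sin (b * x) + b * cos (b * x)) / (a ^+ 2 + b ^+ 2).
have dF (x : R) : is_derive x (1:R) F (expR (- a * x) * cos (b * x)).
  rewrite /F; apply: is_derive_eq; rewrite /GRing.scale /=.
  by field.
have dG (x : R) : is_derive x (1:R) G (- (expR (- a * x) * sin (b * x))).
  rewrite /G; apply: is_derive_eq; rewrite /GRing.scale /=.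
  by field.
have key (f f' : R -> R) : (forall x : R, is_derive x (1:R) f (f' x)) -> continuous f' ->
    Rintegral leb `[s, t[ f' = f t - f s.
  move=> df cf'; have cf : continuous f.
    by move=> x; apply: differentiable_continuous; apply/derivable1_diffP; case: (df x).
  have cw : {within `[s, t], continuous f'} by apply: continuous_subspaceT.
  rewrite Rintegral_itv_bndo_bndc; last first.
    apply: integrableS (continuous_compact_integrable (@segment_compact _ s t) cw) => //.
    exact: subset_itv_co_cc.
  rewrite /Rintegral (continuous_FTC2 st cw (F := f))//.
    split=> [x _||]; first by case: (df x).
      exact/cvg_at_right_filter/cf.
    exact/cvg_at_left_filter/cf.
  by move=> x _; rewrite derive1E; case: (df x).
have c1 : continuous (fun x : R => expR (- a * x)).
  move=> x; apply: continuous_comp; last exact: continuous_expR.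
  by apply: continuousM => //; exact: cst_continuous.
have c2 : continuous (fun x : R => cos (b * x)).
  move=> x; apply: continuous_comp; last exact: continuous_cos.
  by apply: continuousM => //; exact: cst_continuous.
have c3 : continuous (fun x : R => sin (b * x)).
  move=> x; apply: continuous_comp; last exact: continuous_sin.
  by apply: continuousM => //; exact: cst_continuous.
apply: (mulIf al0); rewrite mulfVK//.
have e1 : Rintegral leb `[s, t[ (fun x => Re (cexpn alpha x)) = F t - F s.
  apply: (key F (fun x => expR (- a * x) * cos (b * x))) => // x.
  by apply: cvgM; [exact: c1|exact: c2].
have e2 : Rintegral leb `[s, t[ (fun x => Im (cexpn alpha x)) = G t - G s.
  apply: (key G (fun x => - (expR (- a * x) * sin (b * x)))) => // x.
  by apply: cvgN; apply: cvgM; [exact: c1|exact: c3].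
rewrite /cint e1 e2; apply: complex_ext; rewrite ?cReM ?cImM ?cReD ?cImD /= -/a -/b /F /G.
  by field.
by field.
Qed.

Lemma cvg_cexpn alpha : 0 < Re alpha ->
  Re (cexpn alpha n%:R) @[n --> \oo] --> (0 : R) /\
  Im (cexpn alpha n%:R) @[n --> \oo] --> (0 : R).
Proof.
move=> a0.
have ge : (fun n => normc (cexpn alpha n%:R)) @ \oo --> (0 : R).
  rewrite (_ : (fun n => _) = (fun n => expR (- Re alpha) ^+ n)); last first.
    by apply/funext => n; rewrite normc_cexpn -expRM_natr mulr_natr.
  by apply: cvg_expr; rewrite ger0_norm ?expR_ge0// expR_lt1 oppr_lt0.
have gN : (fun n => - normc (cexpn alpha n%:R)) @ \oo --> (0 : R).
  by rewrite -oppr0; exact: cvgN.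
by split; apply: (squeeze_cvgr _ gN ge); apply: nearW => n; rewrite -ler_norml;
  [exact: Re_le_normc|exact: Im_le_normc].
Qed.

(** Dominated convergence along the intervals [0, n[, whose integrals are explicit, with exp(- alpha
    n) tending to 0. Real and imaginary parts are treated together through a projection [S]. *)
Lemma cint_cexpn alpha : 0 < Re alpha -> cint leb half (cexpn alpha) = alpha^-1.
Proof.
move=> a0.
pose F n (x : R) : C := if x < n%:R then cexpn alpha x else 0.
have cF n : cint leb half (F n) = (1 - cexpn alpha n%:R) / alpha.
  rewrite -(cexpn0 alpha) -cint_cexpn_itv//.
  have e : half `&` [set x : R | x < n%:R] = `[0%R, n%:R[%classic.
    by apply/seteqP; split=> x /=; rewrite !in_itv/= andbT => /andP.
  have ex x : (x \in [set x : R | x < n%:R]) = (x < n%:R).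
    by apply/idP/idP => [/set_mem|/mem_set].
  rewrite /cint -!e !Rintegral_mkcondr; congr Complex; apply: eq_Rintegral => x _;
    by rewrite /F patchE ex; case: ifP.
have lim (S : C -> R) : (forall x y, S (x + y) = S x + S y) -> (S = @complex.Re R \/ S = @complex.Im R) ->
   Rintegral leb half (fun x => S (F n x)) @[n --> \oo] --> Rintegral leb half (fun x => S (cexpn alpha x)).
  move=> _ SE.
  have Sle x : `|S x| <= normc x by case: SE => ->; [exact: Re_le_normc|exact: Im_le_normc].
  have mS n : measurable_fun half (fun x => S (F n x)).
    have [m1 m2] : cmeas half (F n).
      have := @cmeasM _ _ _ half (cexpn alpha) (fun x => toC (\1_[set x : R | x < n%:R] x)).
      rewrite (_ : (fun x => _ * _) = F n); last first.
        apply/funext => x; rewrite /F indicE mul_toC_bool.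
        by rewrite (_ : (x \in _) = (x < n%:R))//; apply/idP/idP => [/set_mem|/mem_set].
      apply; first exact: cmeas_cexpn.
      apply: cmeas_toC; apply: measurable_funTS; apply: measurable_indic.
      by rewrite (_ : [set x | _] = `]-oo, n%:R[%classic).
    by case: SE => ->.
  apply: (Rintegral_cvg _ mS _ (integrable_expR_half a0)) => //.
    move=> x _; apply: cvg_near_cst.
    have [N _ hN] := @nbhs_infty_gtr R x.
    by exists N => // n /hN; rewrite /F => ->.
  move=> n x _; apply: le_trans (Sle _) _; rewrite /F.
  by case: ifP => _; rewrite ?normc0 ?expR_ge0// normc_cexpn.
have [r0 i0] := cvg_cexpn a0.
have lim2 (S : C -> R) (S' : R) : (S = @complex.Re R \/ S = @complex.Im R) ->
   S ((1 - cexpn alpha n%:R) / alpha) @[n --> \oo] --> S (alpha^-1).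
  move=> SE; set b := alpha^-1.
  have -> : S b = S b - (Re (0:C) * S b).
    by rewrite mul0r subr0.
  have SM x y : S (x - y) = S x - S y by case: SE => ->; case: x y => ? ? [].
  under eq_fun do rewrite mulrBl mul1r SM.
  apply: cvgB; first exact: cvg_cst.
  have u0 (u : nat -> R) k : u @ \oo --> (0 : R) -> u n * k @[n --> \oo] --> (0 : R).
    by move=> hu; rewrite -(mul0r k); apply: cvgM => //; exact: cvg_cst.
  rewrite mul0r; case: SE => ->.
    under eq_fun do rewrite cReM.
    by rewrite -(subr0 0); apply: cvgB; exact: u0.
  under eq_fun do rewrite cImM.
  by rewrite -(addr0 0); apply: cvgD; exact: u0.
have fin (S : C -> R) : (S = @complex.Re R \/ S = @complex.Im R) -> S (cint leb half (cexpn alpha)) = S alpha^-1.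
  move=> SE.
  have e f : S (cint leb half f) = Rintegral leb half (fun x => S (f x)) by case: SE => ->.
  rewrite -(cvg_lim (@Rhausdorff R) (lim2 S 0 SE)) e; apply/esym/cvg_lim => //.
  under eq_fun do rewrite -cF e.
  by apply: lim => //; case: SE => -> x y; [exact: cReD|exact: cImD].
by apply: complex_ext; apply: fin; [left|right].
Qed.

Lemma cint_cexpn_indic alpha (s t : R) : 0 < Re alpha -> 0 <= s -> s <= t ->
  cint leb half (fun x => cexpn alpha x * toC (s <= x < t)%R%:R) =
  (cexpn alpha s - cexpn alpha t) / alpha.
Proof.
move=> a0 s0 st; rewrite -cint_cexpn_itv//.
have e : half `&` `[s, t[%classic = `[s, t[%classic.
  apply/seteqP; split=> x /=; first by case.
  by rewrite !in_itv/= andbT => /andP[sx xt]; rewrite sx xt (le_trans s0 sx).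
have ex x : (x \in `[s, t[%classic) = (s <= x < t).
  by apply/idP/idP => [/set_mem|h]; rewrite ?inE /= in_itv.
rewrite /cint -[in RHS]e !Rintegral_mkcondr; congr Complex; apply: eq_Rintegral => x _;
  rewrite ?cReM ?cImM patchE ex; case: ifP => _ /=; rewrite ?mulr1 ?mulr0 ?subr0 ?add0r//.
Qed.

End Exponential.

(** * Exchanging expectation and time integral *)

Section Fubini.
Context d (T : measurableType d) (R : realType) (P : probability T R).
Local Notation C := (R[i]).
Local Notation Re := complex.Re.
Local Notation Im := complex.Im.
Local Notation toC x := (Complex x 0).
Local Notation leb := (@lebesgue_measure R).
Local Notation RM := (measurableTypeR R).
Local Notation half := (`[0%R, +oo[%classic : set RM).

Section RealFubini.
Variables (g : T * RM -> R) (h : R -> R).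
Hypothesis mg : measurable_fun setT g.
Hypothesis ih : leb.-integrable half (EFin \o h).
Hypothesis gh : forall w t, 0 <= t -> `|g (w, t)| <= h t.

(** Extension by 0 to negative times, so that Fubini applies on the product with the whole line. *)
Let G (p : T * RM) : R := if 0 <= p.2 then g p else 0.
Let mG : measurable_fun setT (EFin \o G).
Proof.
apply/measurable_EFinP; apply: measurable_fun_ifT => //.
exact: measurable_fun_ler.
Qed.
Let ih' : leb.-integrable setT (EFin \o (h \_ half)).
Proof. by rewrite -restrict_EFin -integrable_mkcond. Qed.
Let Gle w t : `|G (w, t)| <= (h \_ half) t.
Proof.
rewrite /G patchE mem_setE /= in_itv /= andbT.
by case: ifP => [t0|_]; [exact: gh|rewrite normr0].
Qed.
Let iG1 w : leb.-integrable setT (fun t => (G (w, t))%:E).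
Proof.
apply: le_integrable ih' => //; first exact: (measurableT_comp mG).
by move=> t _ /=; rewrite lee_fin (le_trans (Gle _ _))// ler_norm.
Qed.
Let iG2 t : P.-integrable setT (fun w => (G (w, t))%:E).
Proof.
have ic : P.-integrable setT (EFin \o cst ((h \_ half) t)).
  exact: finite_measure_integrable_cst.
apply: le_integrable ic => //; first exact: (measurableT_comp mG).
by move=> w _ /=; rewrite lee_fin (le_trans (Gle _ _))// ler_norm.
Qed.
Let iG : (P \x leb)%E.-integrable setT (EFin \o G).
Proof.
apply/integrable12ltyP => //.
apply: (@le_lt_trans _ _ (\int[P]_w \int[leb]_t ((h \_ half) t)%:E)%E).
  apply: ge0_le_integral => //.
  - by move=> w _; apply: integral_ge0.
  - apply: (@measurable_fun_fubini_tonelli_F _ _ _ _ _ leb (abse \o (EFin \o G))).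
      exact: measurableT_comp.
    by move=> p; exact: abse_ge0.
  - move=> w _; apply: ge0_le_integral => //.
    + by apply: measurableT_comp => //; exact: measurableT_comp.
    + by apply: (measurable_int leb); exact: ih'.
    + by move=> t _ /=; rewrite lee_fin Gle.
have /fineK <- : (\int[leb]_t ((h \_ half) t)%:E)%E \is a fin_num.
  exact: integrable_fin_num.
set K := fine _.
have iK : P.-integrable setT (EFin \o cst K) by exact: finite_measure_integrable_cst.
by have := integrable_fin_num measurableT iK; rewrite fin_numElt => /andP[].
Qed.

Let inner w : Rintegral leb half (fun t => g (w, t)) = fine (\int[leb]_t (G (w, t))%:E)%E.
Proof.
rewrite Rintegral_mkcond /Rintegral; congr fine; apply: eq_integral => t _.
by rewrite /G patchE mem_setE /= in_itv /= andbT.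
Qed.

Lemma measurable_Rinner : measurable_fun setT (fun w => Rintegral leb half (fun t => g (w, t))).
Proof.
under eq_fun do rewrite inner.
apply: measurableT_comp => //.
exact: (measurable_fubini_F iG).
Qed.

Lemma Rfubini : Rintegral P setT (fun w => Rintegral leb half (fun t => g (w, t))) =
  Rintegral leb half (fun t => Rintegral P setT (fun w => g (w, t))).
Proof.
rewrite [in RHS]Rintegral_mkcond {1 3}/Rintegral; congr fine.
transitivity (\int[P]_w \int[leb]_t (EFin \o G) (w, t))%E.
  by apply: eq_integral => w _; rewrite inner fineK//; exact: integrable_fin_num.
rewrite (Fubini iG); apply: eq_integral => t _.
rewrite patchE mem_setE /= in_itv /= andbT /G; case: ifP => t0; last by rewrite integral0.
rewrite fineK//.
by have := integrable_fin_num measurableT (iG2 t); rewrite /G /= t0.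
Qed.
End RealFubini.

Lemma cfubini (g : T * RM -> C) (h : R -> R) : cmeas setT g ->
  leb.-integrable half (EFin \o h) ->
  (forall w t, 0 <= t -> normc (g (w, t)) <= h t) ->
  cint P setT (fun w => cint leb half (fun t => g (w, t))) =
  cint leb half (fun t => cint P setT (fun w => g (w, t))).
Proof.
move=> [m1 m2] ih gh; congr Complex.
  exact: (Rfubini m1 ih (fun w t t0 => le_trans (Re_le_normc _) (gh w t t0))).
exact: (Rfubini m2 ih (fun w t t0 => le_trans (Im_le_normc _) (gh w t t0))).
Qed.

Lemma cmeas_cinner (g : T * RM -> C) (h : R -> R) : cmeas setT g ->
  leb.-integrable half (EFin \o h) ->
  (forall w t, 0 <= t -> normc (g (w, t)) <= h t) ->
  cmeas setT (fun w => cint leb half (fun t => g (w, t))).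
Proof.
move=> [m1 m2] ih gh; split.
  exact: (measurable_Rinner m1 ih (fun w t t0 => le_trans (Re_le_normc _) (gh w t t0))).
exact: (measurable_Rinner m2 ih (fun w t t0 => le_trans (Im_le_normc _) (gh w t t0))).
Qed.

Lemma cintegrable_bounded (f : T -> C) (M : R) : cmeas setT f ->
  (forall w, normc (f w) <= M) -> cintegrable P setT f.
Proof.
move=> mf fM; apply: (cintegrable_le _ mf (g := cst M)) => //.
exact: finite_measure_integrable_cst.
Qed.

Lemma cint_indic (A : set T) : measurable A ->
  cint P setT (fun w => toC (\1_A w)) = toC (fine (P A)).
Proof.
move=> mA; rewrite /cint /= Rintegral_cst// mul0r; congr Complex.
by rewrite /Rintegral integral_indic// setIT.
Qed.

(* [exp(-alpha h) = 1 - alpha * int_0^oo exp(-alpha t) 1{t < h} dt]; Fubini then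
   reduces the transform of [h] to its tail probabilities. *)
Lemma cint_exp_tail (alpha : C) (q : R) (c : C) (Z : T -> C) (h : T -> R) (M : R) :
  0 < Re alpha -> 0 <= q -> cmeas setT Z -> measurable_fun setT h ->
  (forall w, normc (Z w) <= M) -> (forall w, h w <= 0 -> Z w = 0) ->
  (forall t, 0 <= t ->
     cint P setT (fun w => Z w * toC (\1_[set w' | t < h w'] w)) = c * toC (expR (- q * t))) ->
  cint P setT (fun w => Z w * cexpn alpha (h w)) = c * (toC q / (toC q + alpha)).
Proof.
move=> a0 q0 mZ mh ZM Z0 Zt.
have al0 : alpha != 0 by apply/eqP => e; move: a0; rewrite e ltxx.
have aq0 : 0 < Re (toC q + alpha) by rewrite cReD /= ltr_wpDl.
have qal0 : toC q + alpha != 0 by apply/eqP => e; move: aq0; rewrite e ltxx.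
have M0 : 0 <= M := le_trans (normc_ge0 _) (ZM point).
(* The tail hypothesis at t = 0 gives the mean of [Z], because [Z] vanishes where [h] is not
   positive. *)
have EZ : cint P setT Z = c.
  have := Zt 0 (lexx _); rewrite mulr0 expR0 mulr1 => <-.
  apply: eq_cint => w _; rewrite indicE.
  have [hw|hw] := leP (h w) 0; first by rewrite Z0// mul0r.
  by rewrite mem_set//= mulr1.
pose g (p : T * RM) := Z p.1 * (cexpn alpha p.2 * toC (p.2 < h p.1)%R%:R).
have mg : cmeas setT g.
  have [mZ1 mZ2] := mZ.
  apply: cmeasM.
    by split; [exact: (measurableT_comp mZ1)|exact: (measurableT_comp mZ2)].
  apply: cmeasM; first exact: cmeas_cexpn.
  apply: cmeas_toC; rewrite (_ : (fun x => _) = \1_[set p : T * RM | p.2 < h p.1]).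
    apply: measurable_indic.
    apply: measurable_set_lt => //; exact: measurableT_comp.
  apply/funext => p; rewrite indicE; congr (nat_of_bool _)%:R.
  by apply/idP/idP => [/mem_set|/set_mem].
have ih : leb.-integrable half (EFin \o (fun t => M * expR (- Re alpha * t))).
  have := integrable_expR_half a0; exact: integrableZl.
have gh w t : 0 <= t -> normc (g (w, t)) <= M * expR (- Re alpha * t).
  move=> t0; rewrite /g /= !normcM normc_toC normc_cexpn.
  rewrite ler_pM ?normc_ge0 ?mulr_ge0 ?expR_ge0//.
  by rewrite ler_piMr ?expR_ge0//; case: (_ < _); rewrite ?normr1 ?normr0.
have inner w : cint leb half (fun t => g (w, t)) = Z w * ((1 - cexpn alpha (h w)) / alpha).
  have [hw|hw] := leP (h w) 0.
    rewrite Z0// mul0r; rewrite (@eq_cint _ _ _ _ _ _ (fun=> 0)) => [|t _].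
      by rewrite /cint /= Rintegral_cst// mul0r.
    by rewrite /g /= Z0// mul0r.
  rewrite -(cexpn0 alpha) -cint_cexpn_indic ?(ltW hw)// -cintZ//.
    apply: eq_cint => t /=; rewrite in_itv/= andbT => t0.
    by rewrite /g /= t0.
  apply: cintegrable_le (integrable_expR_half a0) _ => //.
    apply: cmeasM; first exact: cmeas_cexpn.
    apply: cmeas_toC; apply: measurable_funTS.
    rewrite (_ : (fun x => _) = \1_(`[0, h w[%classic)); first exact: measurable_indic.
    apply/funext => t; rewrite indicE; congr (nat_of_bool _)%:R.
    by apply/idP/idP => [|/set_mem]; rewrite ?inE /= in_itv.
  move=> t _; rewrite normcM normc_toC normc_cexpn ler_piMr ?expR_ge0//.
  by case: (_ && _); rewrite ?normr1 ?normr0.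
have swap := cfubini mg ih gh.
have outer : cint leb half (fun t => cint P setT (fun w => g (w, t))) = c / (toC q + alpha).
  rewrite -cint_cexpn// -cintZ//; last exact: cintegrable_cexpn.
  apply: eq_cint => t /=; rewrite in_itv/= andbT => t0.
  rewrite -cexpnDl mulrCA -Zt// -cintZ//.
    apply: eq_cint => w _; rewrite /g /= mulrCA; congr (_ * (_ * toC _)).
    rewrite indicE; congr (nat_of_bool _)%:R.
    by apply/idP/idP => [/mem_set|/set_mem].
  apply: (@cintegrable_bounded _ M).
    apply: cmeasM => //; apply: cmeas_toC; apply: measurable_indic.
    exact: measurable_set_lt.
  move=> w; rewrite normcM normc_toC (le_trans _ (ZM w))// ler_piMr ?normc_ge0//.
  by rewrite indicE; case: (_ \in _); rewrite ?normr1 ?normr0.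
have mE : cmeas setT (fun w => cexpn alpha (h w)) by exact: cmeas_cexpn.
have iZ : cintegrable P setT Z by exact: cintegrable_bounded ZM.
have iZE : cintegrable P setT (fun w => Z w * cexpn alpha (h w)).
  apply: (@cintegrable_bounded _ M); first exact: cmeasM.
  move=> w; have [hw|hw] := leP (h w) 0; first by rewrite Z0// mul0r normc0.
  rewrite normcM (le_trans _ (ZM w))// ler_piMr ?normc_ge0//.
  by apply: normc_cexpn_le1; exact: ltW.
have : cint P setT (fun w => Z w * cexpn alpha (h w)) =
    c - alpha * cint P setT (fun w => cint leb half (fun t => g (w, t))).
  rewrite -{1}EZ -[- (_ * _)]mulNr -cintZ//.
    rewrite -cintD//.
      by apply: eq_cint => w _; rewrite inner; field.
    apply: cintegrableZ => //; under eq_fun do rewrite inner.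
    rewrite (_ : (fun w => _) = (fun w => alpha^-1 * (Z w + (-1) * (Z w * cexpn alpha (h w))))).
      by apply: cintegrableZ => //; apply: cintegrableD => //; apply: cintegrableZ.
    by apply/funext => w; field.
  under eq_fun do rewrite inner.
  rewrite (_ : (fun w => _) = (fun w => alpha^-1 * (Z w + (-1) * (Z w * cexpn alpha (h w))))).
    by apply: cintegrableZ => //; apply: cintegrableD => //; apply: cintegrableZ.
  by apply/funext => w; field.
by move=> ->; rewrite swap outer; field.
Qed.

End Fubini.

(** * Transforms of a Markov chain as path sums *)

Lemma big_pred1_seq_uniq (V : nmodType) (I : eqType) (r : seq I) (i : I) (F : I -> V) :
  uniq r -> i \in r -> \sum_(j <- r) (if j == i then F j else 0) = F i.
Proof.
move=> ur ir; rewrite (bigD1_seq i)//= eqxx big1 ?addr0// => j /negbTE ->//.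
Qed.

Lemma measure_seq_disjoint d (T : measurableType d) (R : realType)
    (mu : {measure set T -> \bar R}) (I : eqType) (s : seq I) (F : I -> set T) :
  uniq s -> (forall i, measurable (F i)) ->
  (forall i j w, F i w -> F j w -> i = j) ->
  mu (\big[setU/set0]_(i <- s) F i) = (\sum_(i <- s) mu (F i))%E.
Proof.
move=> us mF Fd.
have inU r w : (\big[setU/set0]_(i <- r) F i) w -> exists2 j, j \in r & F j w.
  elim: r => [|i r IH]; rewrite ?big_nil ?big_cons// => -[Fi|/IH[j jr Fj]].
    by exists i => //; rewrite mem_head.
  by exists j => //; rewrite inE jr orbT.
elim: s us => [|i s IH] /=; first by rewrite !big_nil measure0.
move=> /andP[si us]; rewrite !big_cons measureU//; last 2 first.
  exact: bigsetU_measurable.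
  apply/seteqP; split=> // w [Fiw] /inU[j js Fjw].
  by move: si; rewrite (Fd _ _ _ Fiw Fjw) js.
by congr (_ + _)%E; exact: IH.
Qed.

Lemma has_csum_single (R : realType) (f : nat -> R[i]) (m : nat) :
  (forall n, n != m -> f n = 0) -> has_csum f (f m).
Proof.
move=> f0; apply/(@has_csum_shift _ _ _ m) => [n nm|]; first by rewrite f0// ltn_eqF.
rewrite -[f m]addr0 -{2}[m]add0n.
apply/has_csum_recl.
under eq_fun => n do rewrite f0 ?addSn ?gtn_eqF ?ltnS ?leq_addl//.
exact: has_csum0.
Qed.

Lemma sum_single_le (R : realType) (f : nat -> R[i]) (M : R) n : 0 <= M ->
  (forall k, normc (f k) <= M) -> (forall k l, f k != 0 -> f l != 0 -> k = l) ->
  normc (\sum_(k < n) f k) <= M.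
Proof.
move=> M0 fM f1; elim: n => [|n IH]; first by rewrite big_ord0 normc0.
rewrite big_ord_recr /=; have [->|fn] := eqVneq (f n) 0; first by rewrite addr0.
rewrite big1 ?add0r// => k _; apply/eqP; apply: contraT => fk.
by have := ltn_ord k; rewrite (f1 _ _ fk fn) ltnn.
Qed.

Lemma cint_norm_le d (T : measurableType d) (R : realType)
    (mu : {measure set T -> \bar R}) (D : set T) (f : T -> R[i]) (g : T -> R) :
  measurable D -> cmeas D f -> mu.-integrable D (EFin \o g) ->
  (forall x, D x -> normc (f x) <= g x) ->
  normc (cint mu D f) <= Rintegral mu D g + Rintegral mu D g.
Proof.
move=> mD mf ig fg; have [i1 i2] := cintegrable_le mD mf ig fg.
apply: le_trans (normc_le_ReIm _) _; rewrite /cint /=; apply: lerD.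
  apply: le_trans (le_normr_Rintegral mD i1) _; apply: le_Rintegral => //.
    exact: integrable_norm.
  by move=> x Dx; exact: le_trans (Re_le_normc _) (fg _ Dx).
apply: le_trans (le_normr_Rintegral mD i2) _; apply: le_Rintegral => //.
  exact: integrable_norm.
by move=> x Dx; exact: le_trans (Im_le_normc _) (fg _ Dx).
Qed.

(** * Finite-dimensional laws with discounted holding times *)

Section Chain.
Context d (T : measurableType d) (R : realType) (P : probability T R).
Local Notation C := (R[i]).
Local Notation Re := complex.Re.
Local Notation Im := complex.Im.
Local Notation toC x := (Complex x 0).
Variables (q : nnrates R) (z0 : state) (Y : nat -> T -> state) (H : nat -> T -> R).
Hypothesis chain : is_ctmc P q z0 Y H.
Hypothesis q_gt0 : forall z, 0 < qtot q z.
Variable alpha : C.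
Hypothesis alpha_gt0 : 0 < Re alpha.
Implicit Types (ys : nat -> state) (ts : nat -> R).

Local Notation J := (jtime H).

Let mY k (B : set state) : measurable (Y k @^-1` B).
Proof.
have [mY1 _] := chain.
(* The state space is countable, so measurability on singletons is enough. *)
rewrite (_ : Y k @^-1` B = \bigcup_n (if unpickle n is Some x then
    (if x \in B then Y k @^-1` [set x] else set0) else set0)).
  apply: bigcup_measurable => n _; case: (unpickle n) => [x|//].
  by case: ifP.
apply/seteqP; split=> [w Bw|w [n _]].
  by exists (pickle (Y k w)) => //; rewrite pickleK mem_set.
case: (unpickle n) => [x|//]; case: ifP => // /set_mem Bx.
by rewrite /preimage /= => ->.
Qed.
Let mH k : measurable_fun setT (H k).
Proof. by have [_ []] := chain. Qed.
Let mJ n : measurable_fun setT (J n).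
Proof. by apply: measurable_sum => k. Qed.

Definition prefix n ys ts : set T :=
  [set w | forall k, (k <= n)%N -> Y k w = ys k /\ ts k < H k w].

Lemma measurable_prefix n ys ts : measurable (prefix n ys ts).
Proof.
rewrite (_ : prefix n ys ts = \bigcap_k (if (k <= n)%N then
   Y k @^-1` [set ys k] `&` [set w | ts k < H k w] else setT)).
  apply: bigcapT_measurable => k; case: ifP => // _; apply: measurableI => //.
  exact: measurable_set_lt.
apply/seteqP; split=> [w h k _|w h k kn]; first by case: ifP => // /h.
by have := h k I; rewrite kn.
Qed.

Lemma prefix_J n ys ts j w : prefix n ys ts w -> (forall k, 0 <= ts k) -> (j <= n.+1)%N ->
  0 <= J j w.
Proof.
move=> pw ts0 jn; apply: sumr_ge0 => k _.
have [|_] := pw k; first by rewrite -ltnS (leq_trans (ltn_ord k)).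
by move=> /ltW; apply: le_trans.
Qed.

Let law n ys : R := (ys 0%N == z0)%:R * \prod_(k < n) pjump q (ys k) (ys k.+1).

(** Induction on the number [j] of holding times moved from the event into the exponent; the
    thresholds of those already moved must be 0. To move [H j], its tail event {t < H j} is absorbed
    into the prefix as the threshold [t] at index [j], the induction hypothesis then gives an
    exponential tail in [t], and [cint_exp_tail] integrates it. *)
Lemma cint_prefix n ys j ts : (j <= n.+1)%N -> (forall k, 0 <= ts k) ->
  (forall k, (k < j)%N -> ts k = 0) ->
  cint P setT (fun w => toC (\1_(prefix n ys ts) w) * cexpn alpha (J j w)) =
  toC (law n ys) * \prod_(0 <= k < j) (toC (qtot q (ys k)) / kden q alpha (ys k))
  * toC (\prod_(j <= k < n.+1) expR (- qtot q (ys k) * ts k)).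
Proof.
elim: j ts => [|j IH] ts jn ts0 tsj.
  under eq_cint => w _ do rewrite /jtime big_ord0 cexpn0 mulr1.
  rewrite cint_indic; last exact: measurable_prefix.
  have [_ [_ lawP]] := chain.
  rewrite /prefix lawP//=.
  by rewrite big_nil mulr1 !toCM !big_mkord.
pose tj t k := if k == j then t else ts k.
have tj0 t : 0 <= t -> forall k, 0 <= tj t k by move=> t0 k; rewrite /tj; case: ifP.
have mp : measurable (prefix n ys ts) := measurable_prefix _ _ _.
have mZ : cmeas setT (fun w => toC (\1_(prefix n ys ts) w) * cexpn alpha (J j w)).
  by apply: cmeasM; [apply: cmeas_toC; exact: measurable_indic|exact: cmeas_cexpn].
pose c := toC (law n ys) * \prod_(0 <= k < j) (toC (qtot q (ys k)) / kden q alpha (ys k))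
  * toC (\prod_(j.+1 <= k < n.+1) expR (- qtot q (ys k) * ts k)).
have := @cint_exp_tail _ _ _ P alpha (qtot q (ys j)) c
   (fun w => toC (\1_(prefix n ys ts) w) * cexpn alpha (J j w)) (H j) 1 alpha_gt0
   (ltW (q_gt0 _)) mZ (mH j).
under eq_cint => w _ do rewrite -mulrA -cexpnD.
rewrite (_ : (fun w => toC (\1_(prefix n ys ts) w) * cexpn alpha (J j w + H j w)) =
   (fun w => toC (\1_(prefix n ys ts) w) * cexpn alpha (J j.+1 w))); last first.
  by apply/funext => w; rewrite /jtime big_ord_recr.
move=> ->; first last.
- move=> t t0; rewrite -mulrA -toCM.
  rewrite (_ : (fun w => _) = (fun w => toC (\1_(prefix n ys (tj t)) w) * cexpn alpha (J j w))).
    rewrite IH//; [|exact: ltnW|exact: tj0|]; last first.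
      by move=> k kj; rewrite /tj ltn_eqF// tsj// ltnW.
    rewrite (@big_ltn _ _ _ j)// {1}/tj eqxx /c -!mulrA; congr (_ * (_ * _)).
    rewrite [in RHS]mulrC; congr (Complex (_ * _) 0).
    by apply: eq_big_nat => k /andP[jk _]; rewrite /tj gtn_eqF.
  apply/funext => w; rewrite mulrAC -toCM; congr (toC _ * _).
  rewrite !indicE -natrM mulnb; congr (nat_of_bool _)%:R.
  apply/idP/idP => [/andP[/set_mem pw /set_mem tw]|/set_mem pw].
    rewrite inE => k kn; have [-> tk] := pw k kn; split=> //.
    by rewrite /tj; case: eqP => [->|_].
  apply/andP; split; rewrite inE.
    move=> k kn; have [-> tk] := pw k kn; split=> //; move: tk; rewrite /tj.
    by case: eqP => // -> tk; rewrite tsj//; exact: le_lt_trans tk.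
  by have [_] := pw j jn; rewrite /tj eqxx.
- move=> w Hw; rewrite indicE memNset ?mul0r// => pw.
  by have [_] := pw j jn; rewrite tsj// ltNge Hw.
- move=> w; rewrite indicE; have [/set_mem pw|_] := boolP (w \in _); last first.
    by rewrite mul0r normc0.
  by rewrite mul1r normc_cexpn_le1 ?(ltW alpha_gt0)//; apply: prefix_J pw ts0 (ltnW jn).
rewrite /c [in RHS]big_nat_recr//= -!mulrA; congr (_ * (_ * _)).
by rewrite mulrC -mulrA.
Qed.

Definition kweight n ys : C :=
  toC (ys 0%N == z0)%:R * \prod_(k < n) kernel q alpha (ys k) (ys k.+1).
(* [b] says whether the holding time in the last state [y] is included in the
   exponent. *)
Definition kstay (b : bool) (y : state) : C :=
  if b then toC (qtot q y) / kden q alpha y else 1.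

Lemma cint_prefix0 n ys (b : bool) :
  cint P setT (fun w => toC (\1_(prefix n ys (fun=> 0)) w) * cexpn alpha (J (n + b) w)) =
  kweight n ys * kstay b (ys n).
Proof.
rewrite cint_prefix//; last by case: b; rewrite ?addn1 ?addn0.
rewrite [X in _ * toC X](_ : _ = 1); last first.
  by rewrite big1// => k _; rewrite mulr0 expR0.
rewrite mulr1 /law /kweight toCM -!mulrA; congr (_ * _).
rewrite (_ : \prod_(0 <= k < n + b) _ = (\prod_(k < n) (toC (qtot q (ys k)) / kden q alpha (ys k)))
   * kstay b (ys n)).
  rewrite mulrA (big_morph (fun x => toC x) (id1 := 1) (op1 := *%R)); [|exact: toCM|by []].
  rewrite -big_split /=; congr (_ * _); apply: eq_bigr => k _.
  rewrite /kernel mulrA -toCM /pjump -mulrA mulVf ?mulr1// gt_eqF//.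
case: b; rewrite /kstay /= ?addn1 ?addn0 ?mulr1 ?big_mkord//.
by rewrite big_ord_recr.
Qed.

Hypothesis q_ge0 : forall z y, 0 <= qrate q z y.

Lemma sum_pjump z : \sum_(y <- nb z) pjump q z y = 1.
Proof. by rewrite -mulr_suml -qtot_nb mulfV// gt_eqF. Qed.

Let upd n ys (y : state) (k : nat) := if k == n then y else ys k.

Let updnn n ys y : upd n ys y n = y.
Proof. by rewrite /upd eqxx. Qed.

Let updE n ys y k : (k < n)%N -> upd n ys y k = ys k.
Proof. by move=> kn; rewrite /upd ltn_eqF. Qed.

Lemma prefix_upd n ys y w : prefix n.+1 (upd n.+1 ys y) (fun=> 0) w <->
  prefix n ys (fun=> 0) w /\ Y n.+1 w = y /\ 0 < H n.+1 w.
Proof.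
split=> [h|[h [Yn Hn]] k].
  split; last by have := h n.+1 (leqnn _); rewrite /upd eqxx.
  by move=> k kn; have := h k (leqW kn); rewrite updE.
rewrite leq_eqVlt => /predU1P[->|]; first by rewrite /upd eqxx.
by rewrite ltnS => kn; rewrite updE//; exact: h.
Qed.

Lemma law_upd n ys y : law n.+1 (upd n.+1 ys y) = law n ys * pjump q (ys n) y.
Proof.
rewrite /law big_ord_recr /= updnn !updE// mulrA; congr (_ * _ * _).
by apply: eq_bigr => k _; rewrite !updE ?ltnS ?(ltnW (ltn_ord k)) ?ltn_ord.
Qed.

Lemma prob_prefix n ys : P (prefix n ys (fun=> 0)) = (law n ys)%:E.
Proof.
have [_ [_ lawP]] := chain; rewrite /prefix lawP//.
by rewrite [X in _ * X]big1 ?mulr1// => k _; rewrite mulr0 expR0.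
Qed.

(** The extended prefixes are disjoint parts of the prefix, and their probabilities already add up
    to its own since the jump probabilities to the neighbours sum to 1; the remainder is a null
    set. *)
Lemma prefix_step n ys : P (prefix n ys (fun=> 0) `\`
  \big[setU/set0]_(y <- nb (ys n)) prefix n.+1 (upd n.+1 ys y) (fun=> 0)) = 0%E.
Proof.
have mp m us : measurable (prefix m us (fun=> 0)) by exact: measurable_prefix.
have mU : measurable (\big[setU/set0]_(y <- nb (ys n)) prefix n.+1 (upd n.+1 ys y) (fun=> 0)).
  exact: bigsetU_measurable.
rewrite measureD//; last by rewrite ltey_eq fin_num_measure.
rewrite setIidr; last first.
  elim/big_ind: _ => // [A B ? ?|y _]; first by rewrite subUset.
  by move=> w /prefix_upd[].
transitivity ((law n ys)%:E - (law n ys)%:E)%E; last by rewrite -EFinB subrr.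
congr (_ - _)%E; first exact: prob_prefix.
transitivity (\sum_(y <- nb (ys n)) P (prefix n.+1 (upd n.+1 ys y) (fun=> 0%R)))%E.
  apply: measure_seq_disjoint => //; first exact: nb_uniq.
  by move=> y y' w /prefix_upd[_ [<- _]] /prefix_upd[_ [<- _]].
under eq_bigr do rewrite prob_prefix law_upd.
by rewrite sumEFin -mulr_sumr sum_pjump mulr1.
Qed.

(** The finite-dimensional laws exclude a jump to a non-neighbour or a nonpositive holding time only
    almost surely, so this is what licenses pathwise reasoning. *)
Lemma ae_path : \forall w \ae P, Y 0%N w = z0 /\
  forall k, 0 < H k w /\ Y k.+1 w \in nb (Y k w).
Proof.
(* Each null set depends on finitely many entries of the state sequence. Coding finite sequences by
   integers leaves countably many null sets, whose union is null. *)
pose ex (s : seq state) k := nth z0 s k.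
pose unp m : seq state := odflt [::] (unpickle m).
have a0 : \forall w \ae P, prefix 0 (fun=> z0) (fun=> 0) w.
  exists (~` prefix 0 (fun=> z0) (fun=> 0)); split => //.
    by apply: measurableC; exact: measurable_prefix.
  rewrite probability_setC ?prob_prefix; last exact: measurable_prefix.
  by rewrite /law big_ord0 eqxx mulr1 -EFinB subrr.
have a1 : \forall w \ae P, forall n m,
    prefix n (ex (unp m)) (fun=> 0) w ->
    (\big[setU/set0]_(y <- nb (ex (unp m) n)) prefix n.+1 (upd n.+1 (ex (unp m)) y) (fun=> 0)) w.
  apply: ae_foralln => n; apply: ae_foralln => m.
  set s := unp m.
  exists (prefix n (ex s) (fun=> 0) `\`
     \big[setU/set0]_(y <- nb (ex s n)) prefix n.+1 (upd n.+1 (ex s) y) (fun=> 0)); split.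
  - apply: measurableD; first exact: measurable_prefix.
    by apply: bigsetU_measurable => y _; exact: measurable_prefix.
  - exact: prefix_step.
  - by move=> w /= /not_implyP.
apply: filterS2 a0 a1 => w w0 w1.
have inU n ys : (\big[setU/set0]_(y <- nb (ys n)) prefix n.+1 (upd n.+1 ys y) (fun=> 0)) w ->
   Y n.+1 w \in nb (ys n) /\ 0 < H n.+1 w.
  elim: (nb (ys n)) => [|y r IH]; rewrite ?big_nil ?big_cons// => -[|/IH[h1 h2]].
    by move=> /prefix_upd[_ [<- h]]; rewrite mem_head.
  by rewrite inE h1 orbT.
have step n : prefix n (fun k => Y k w) (fun=> 0) w ->
    Y n.+1 w \in nb (Y n w) /\ 0 < H n.+1 w.
  move=> pn; pose s := mkseq (fun k => Y k w) n.+1.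
  have exs k : (k <= n)%N -> ex s k = Y k w by move=> kn; rewrite /ex nth_mkseq.
  have := w1 n (pickle s); rewrite /unp pickleK /= => h.
  have /inU : (\big[setU/set0]_(y <- nb (ex s n)) prefix n.+1 (upd n.+1 (ex s) y) (fun=> 0)) w.
    by apply: h => k kn; rewrite exs//; exact: pn.
  by rewrite exs.
have all n : prefix n (fun k => Y k w) (fun=> 0) w.
  elim: n => [|n IH] k; first by rewrite leqn0 => /eqP ->; have [] := w0 0%N (leqnn _).
  rewrite leq_eqVlt => /predU1P[->|]; last by rewrite ltnS; exact: IH.
  by have [] := step n IH.
split; first by have [] := w0 0%N (leqnn _).
move=> k; split; last by have [] := step k (all k).
by have [] := all k k (leqnn _).
Qed.

(** * Path events with a taboo set *)

Section Taboo.
Variables (A : pred state) (y : state).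

(** The first [m] steps are left to a prefix event and the taboo bears on the next [n] steps, both
    end points being exempt as in [tab]. Positive holding times keep the discount factor at most 1
    in norm. *)
Definition taboo m n : set T := [set w | (forall k, (0 < k < n)%N -> A (Y (m + k)%N w)) /\
  Y (m + n)%N w = y /\ forall k, (k <= m + n)%N -> 0 < H k w].

Lemma measurable_taboo m n : measurable (taboo m n).
Proof.
rewrite (_ : taboo m n = (\bigcap_k (if (0 < k < n)%N then Y (m + k)%N @^-1` [set x | A x] else setT))
  `&` ((Y (m + n)%N @^-1` [set y]) `&`
  (\bigcap_k (if (k <= m + n)%N then [set w | 0 < H k w] else setT)))).
  apply: measurableI; first by apply: bigcapT_measurable => k; case: ifP.
  apply: measurableI => //; apply: bigcapT_measurable => k; case: ifP => // _.
  exact: measurable_set_lt.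
apply/seteqP; split=> [w [h1 [h2 h3]]|w [h1 [h2 h3]]]; split.
- by move=> k _; case: ifP => // /h1.
- by split=> // k _; case: ifP => // /h3.
- by move=> k kn; have := h1 k I; rewrite kn.
- by split=> // k kn; have := h3 k I; rewrite kn.
Qed.

Lemma taboo_J m n j w : taboo m n w -> (j <= (m + n).+1)%N -> 0 <= J j w.
Proof.
move=> [_ [_ h]] jn; apply: sumr_ge0 => k _; apply/ltW/h.
by rewrite -ltnS (leq_trans (ltn_ord k)).
Qed.

Let I m n ys (b : bool) w : C :=
  toC (\1_(prefix m ys (fun=> 0) `&` taboo m n) w) * cexpn alpha (J (m + n + b) w).

Let mS m n ys : measurable (prefix m ys (fun=> 0) `&` taboo m n).
Proof. by apply: measurableI; [exact: measurable_prefix|exact: measurable_taboo]. Qed.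

Let mI m n ys b : cmeas setT (I m n ys b).
Proof.
by apply: cmeasM; [apply: cmeas_toC; exact: measurable_indic|exact: cmeas_cexpn].
Qed.

Let I_le1 m n ys b w : normc (I m n ys b w) <= 1.
Proof.
rewrite /I indicE; have [/set_mem[_ tw]|_] := boolP (w \in _); last first.
  by rewrite mul0r normc0.
rewrite mul1r normc_cexpn_le1 ?(ltW alpha_gt0)//.
by apply: (taboo_J tw); case: b; rewrite ?addn1 ?addn0.
Qed.

Let kweight_upd n ys z : kweight n.+1 (upd n.+1 ys z) = kweight n ys * kernel q alpha (ys n) z.
Proof.
rewrite /kweight big_ord_recr /= updnn !updE// mulrA; congr (_ * _ * _).
by apply: eq_bigr => k _; rewrite !updE ?ltnS ?(ltnW (ltn_ord k)) ?ltn_ord.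
Qed.

(** The prescribed prefix makes the induction on [n] possible: the next state moves into the prefix,
    which multiplies [kweight] by one kernel entry, exactly the step by which [tab] unfolds. *)
Lemma cint_taboo m n ys b : cint P setT (I m n ys b) =
  kweight m ys * tab q alpha A y n (ys m) * kstay b y.
Proof.
elim: n m ys => [|n IH] m ys.
  have [ym|ym] := eqVneq (ys m) y; last first.
    rewrite /= (negbTE ym) mulr0 mul0r.
    rewrite (_ : I m 0 ys b = fun w => toC (\1_set0 w)).
      by rewrite cint_indic// measure0.
    apply/funext => w; rewrite /I !indicE memNset; last first.
      by move=> [pw [_ [yw _]]]; move: ym; have [<- _] := pw m (leqnn _); rewrite -yw addn0 eqxx.
    by rewrite mul0r in_set0.
  rewrite /= ym eqxx mulr1 -ym -cint_prefix0.
  apply: eq_cint => w _; rewrite /I addn0 !indicE; congr (toC _%:R * _); congr nat_of_bool.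
  apply/idP/idP => [/set_mem[]|/set_mem pw]; rewrite inE//.
  split=> //; split; first by case.
  rewrite addn0; split; first by rewrite -ym; have [] := pw m (leqnn _).
  by move=> k kn; have [] := pw k kn.
(* Almost surely, on the prefix event, exactly one neighbour of [ys m] is the next state, so the
   integrand splits over the neighbours. The first factor reproduces the exemption of the last
   vertex in [tab]. *)
rewrite (_ : cint _ _ _ = cint P setT (fun w => \sum_(z <- nb (ys m))
   (toC ((n == 0%N) || A z)%:R * I m.+1 n (upd m.+1 ys z) b w))).
  have iI z : cintegrable P setT (I m.+1 n (upd m.+1 ys z) b) by exact: cintegrable_bounded.
  rewrite (cint_sum _ measurableT _).2; last by move=> z; exact: cintegrableZ.
  rewrite /= /kop mulr_sumr mulr_suml; apply: eq_bigr => z _.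
  rewrite cintZ// IH kweight_upd /upd eqxx.
  by case: ifP => _ /=; rewrite ?mulr0 ?mul0r ?mul1r// !mulrA.
apply: ae_eq_cint => //.
  by apply: cmeas_sum => z; apply: cmeasM; [exact: cmeas_cst|exact: mI].
apply: filterS ae_path => w [_ good] _.
rewrite /I addSnnS; set E := cexpn _ _.
rewrite (eq_bigr (fun z => if z == Y m.+1 w then
   toC (\1_(prefix m ys (fun=> 0) `&` taboo m n.+1) w) * E else 0)); last first.
  move=> z _; rewrite !indicE; case: (z =P Y m.+1 w) => [->|zY]; last first.
    by rewrite memNset ?mul0r ?mulr0// => -[/prefix_upd[_ [/esym]]].
  rewrite mulrA -toCM -natrM mulnb; congr (toC _%:R * _); congr nat_of_bool.
  apply/idP/idP.
    move=> /andP[nA /set_mem[/prefix_upd[pw [_ Hm]] [tA [tY tH]]]]; rewrite inE.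
    split=> //; split; last by rewrite -addSnnS.
    move=> [//|k]; rewrite ltnS -addSnnS => /andP[_ kn]; have [k0|k0] := posnP k.
      rewrite k0 addn0; case/orP: nA => [/eqP n0|//].
      by rewrite n0 k0 in kn.
    by apply: tA; rewrite k0.
  move=> /set_mem[pw [tA [tY tH]]].
  have nA : (n == 0%N) || A (Y m.+1 w).
    have [//|n0] := eqVneq n 0%N; apply/orP; right.
    by have := tA 1%N; rewrite addn1; apply; rewrite /= ltnS lt0n.
  rewrite nA inE; split.
    by apply/prefix_upd; split=> //; split=> //; case: (good m.+1).
  split; last by rewrite addSnnS.
  by move=> k /andP[k0 kn]; rewrite addSnnS; apply: tA; rewrite ltnS.
have [/set_mem[pw _]|nS] := boolP (w \in prefix m ys (fun=> 0) `&` taboo m n.+1).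
  rewrite big_pred1_seq_uniq//; first exact: nb_uniq.
  by have [<- _] := pw m (leqnn _); case: (good m).
have e0 : toC (\1_(prefix m ys (fun=> 0) `&` taboo m n.+1) w) * E = 0.
  by rewrite indicE (negbTE nS) mul0r.
by rewrite e0 big1// => z _; rewrite if_same.
Qed.

End Taboo.

(** * Hitting, occupation and state transforms *)

Section Transforms.
Variables (B : set state) (y : state).
Let A : pred state := fun x => x \notin B.
Local Notation leb := (@lebesgue_measure R).
Local Notation RM := (measurableTypeR R).
Local Notation half := (`[0%R, +oo[%classic : set RM).

(** Off this almost sure event the times [J n] may be negative and the discount factors exceed 1.
    Multiplying by its indicator leaves the expectations unchanged and makes the bounds hold at
    every point. *)
Let G : set T := [set w | Y 0%N w = z0 /\ forall k, 0 < H k w].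
Let mG : measurable G.
Proof.
rewrite (_ : G = Y 0%N @^-1` [set z0] `&` \bigcap_k [set w | 0 < H k w]).
  apply: measurableI => //; apply: bigcapT_measurable => k.
  exact: measurable_set_lt.
by apply/seteqP; split=> w [w0 h]; split=> // k; [move=> _; exact: h|exact: (h k I)].
Qed.
Let aeG : \forall w \ae P, w \in G.
Proof.
by apply: filterS ae_path => w [w0 h]; rewrite inE; split=> // k; case: (h k).
Qed.
Let JG n m w : G w -> (n <= m)%N -> 0 <= J n w <= J m w.
Proof.
move=> [_ h] nm; rewrite /jtime sumr_ge0 => [/=|k _]; last exact/ltW/h.
rewrite -(subnKC nm) big_split_ord /= lerDl sumr_ge0// => k _; exact/ltW/h.
Qed.

Let path n : set T := [set w | (forall k, (0 < k < n)%N -> ~ B (Y k w)) /\ Y n w = y].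
Let mpath n : measurable (path n).
Proof.
rewrite (_ : path n = (\bigcap_k (if (0 < k < n)%N then Y k @^-1` (~` B) else setT))
   `&` Y n @^-1` [set y]).
  by apply: measurableI => //; apply: bigcapT_measurable => k; case: ifP.
apply/seteqP; split=> w [h1 h2]; split=> // k; first by move=> _; case: ifP => // /h1.
by move=> kn; have := h1 k I; rewrite kn.
Qed.

Let cint_path n (b : bool) : cint P setT (fun w => toC (\1_G w) *
    (toC (\1_(path n) w) * cexpn alpha (J (n + b) w))) = tab q alpha A y n z0 * kstay b y.
Proof.
have := @cint_taboo A y 0 n (fun=> z0) b.
rewrite /kweight big_ord0 eqxx mulr1 mul1r => <-.
apply: ae_eq_cint => //.
- do 2 (apply: cmeasM; first by apply: cmeas_toC; exact: measurable_indic).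
  exact: cmeas_cexpn.
- apply: cmeasM; last exact: cmeas_cexpn.
  apply: cmeas_toC; apply: measurable_indic; apply: measurableI.
    exact: measurable_prefix.
  exact: measurable_taboo.
apply: filterS aeG => w wG _; rewrite [in LHS]indicE wG mul1r add0n.
congr (toC _ * _); rewrite !indicE; congr (nat_of_bool _)%:R.
have {wG} [w0 wH] := set_mem wG.
apply/idP/idP => /set_mem; rewrite inE.
  move=> [h1 h2]; split; first by move=> k; rewrite leqn0 => /eqP ->.
  split=> // k kn; rewrite add0n /A; apply/negP => /set_mem; exact: h1.
move=> [_ [h1 [h2 _]]]; split=> // k kn Bk.
by have := h1 k kn; rewrite add0n /A => /negP; apply; exact: mem_set.
Qed.

Variable Q : R.
Hypothesis q_le : forall z, qtot q z <= Q.

(** A trajectory has at most one first hitting index, so the series under the expectation has at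
    most one nonzero term, of norm at most 1 on [G], and may be integrated term by term. With [y] in
    [B], hitting at step n >= 1 in [y] is the event [path n]. *)
Lemma hitLTE : B y -> hitLT P Y H B y alpha = hits q alpha A y z0.
Proof.
move=> By.
pose f n w : C := toC (\1_[set w' | first_hit Y B n w' /\ Y n w' = y] w) * cexpn alpha (J n w).
have fE n w : f n w = if n == 0%N then 0 else toC (\1_(path n) w) * cexpn alpha (J n w).
  rewrite /f; case: n => [|n] /=.
    by rewrite indicE memNset ?mul0r// => -[[]].
  congr (toC (\1_ _ w) * _); apply/seteqP; split=> w'.
    by move=> [[_ [_ h]] yn]; split=> // k /andP[k0 kn]; exact: h.
  move=> [h yn]; split=> //; split=> //; split; first by rewrite yn.
  by move=> k k0 kn; apply: h; rewrite k0.
have fN n w : f n w != 0 -> (0 < n)%N /\ path n w.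
  rewrite fE; case: n => [|n] /=; first by rewrite eqxx.
  rewrite indicE; have [/set_mem//|_] := boolP (w \in _); by rewrite mul0r eqxx.
have f1 w n m : f n w != 0 -> f m w != 0 -> n = m.
  wlog: n m / (n <= m)%N => [hw fn fm|].
    by case/orP: (leq_total n m) => nm; [exact: hw|apply/esym/hw].
  rewrite leq_eqVlt => /predU1P[//|nm] /fN[n0 [_ Yn]] /fN[_ [h _]].
  by case: (h n); rewrite ?n0 ?nm// Yn.
have fs w : has_csum (f ^~ w) (csum (f ^~ w)).
  have [[m fm]|/forallNP f0] := pselect (exists m, f m w != 0).
    have hm : has_csum (f ^~ w) (f m w).
      apply: has_csum_single => n nm; apply/eqP; apply: contraT => fn.
      by rewrite (f1 _ _ _ fn fm) eqxx in nm.
    by rewrite (has_csumE hm).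
  have h0 : has_csum (f ^~ w) (f 0%N w).
    by apply: has_csum_single => n _; apply/eqP; apply: contraT => /f0.
  by rewrite (has_csumE h0).
have mf n : cmeas setT (f n).
  rewrite (_ : f n = fun w => toC (n != 0%N)%:R * (toC (\1_(path n) w) * cexpn alpha (J n w))).
    apply: cmeasM; first exact: cmeas_cst.
    by apply: cmeasM; [apply: cmeas_toC; exact: measurable_indic|exact: cmeas_cexpn].
  by apply/funext => w; rewrite fE; case: eqP => _; rewrite ?mul0r ?mul1r.
have mfs : cmeas setT (fun w => csum (f ^~ w)).
  by apply: cmeas_csum mf _ => w _; exact: fs.
have mGc : cmeas setT (fun w => toC (\1_G w : R)).
  by apply: cmeas_toC; exact: measurable_indic.
have -> : hitLT P Y H B y alpha = cint P setT (fun w => toC (\1_G w) * csum (f ^~ w)).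
  apply: ae_eq_cint => //; first exact: cmeasM.
  by apply: filterS aeG => w wG _; rewrite indicE wG mul1r.
(* The summand of index 0 vanishes, since a hit needs a jump; it is split off to match [hits], which
   starts at length 1. *)
suff h : has_csum (fun n => cint P setT (fun w => toC (\1_G w) * f n w))
    (0 + hits q alpha A y z0).
  have := has_csumE h; rewrite add0r => <-; apply/esym/has_csumE.
  apply: (cint_csum (g := cst 1)) => //.
  - by move=> n; exact: cmeasM.
  - exact: finite_measure_integrable_cst.
  - move=> n w _; rewrite /cst.
    apply: (@sum_single_le R (fun k => toC (\1_G w) * f k w)) => //.
      move=> k; rewrite indicE; have [/set_mem wG|_] := boolP (w \in G); last first.
        by rewrite mul0r normc0.
      rewrite mul1r fE; case: eqP => _; first by rewrite normc0.
      rewrite indicE; case: (_ \in _); last by rewrite mul0r normc0.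
      rewrite mul1r normc_cexpn_le1 ?(ltW alpha_gt0)//.
      by have /andP[] := JG wG (leqnn k).
    have f0 k : toC (\1_G w) * f k w != 0 -> f k w != 0.
      by apply: contraNN => /eqP ->; rewrite mulr0.
    by move=> k l /f0 fk /f0 fl; exact: f1 fk fl.
  - by move=> w _; apply: has_csumZ; exact: fs.
have -> : 0 = cint P setT (fun w => toC (\1_G w) * f 0%N w).
  rewrite (_ : (fun w => _) = fun w => toC (\1_set0 w)); first by rewrite cint_indic// measure0.
  by apply/funext => w; rewrite fE eqxx mulr0 indicE in_set0.
apply/(has_csum_recl (fun n => cint P setT (fun w => toC (\1_G w) * f n w))).
rewrite (_ : (fun n => _) = (fun n => tab q alpha A y n.+1 z0)).
  exact: has_csum_hits.
apply/funext => n; rewrite -[RHS]mulr1 -(cint_path n.+1 false) addn0.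
by under eq_cint => w _ do rewrite fE /=.
Qed.

Let rect n : set (T * RM) := [set p | path n p.1 /\ J n p.1 <= p.2 /\ p.2 < J n.+1 p.1].
Let mrect n : measurable (rect n).
Proof.
rewrite (_ : rect n = (path n `*` setT) `&` ([set p | J n p.1 <= p.2] `&` [set p | p.2 < J n.+1 p.1])).
  apply: measurableI; first exact: measurableX.
  apply: measurableI; [apply: measurable_set_le|apply: measurable_set_lt] => //;
    exact: measurableT_comp.
by apply/seteqP; split=> [p [h1 [h2 h3]]|p [[h1 _] [h2 h3]]].
Qed.

Let cell n (p : T * RM) : C := cexpn alpha p.2 * toC (\1_(rect n) p).
Let mcell n : cmeas setT (cell n).
Proof.
by apply: cmeasM; [exact: cmeas_cexpn|apply: cmeas_toC; exact: measurable_indic].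
Qed.
Let cell_le n w t : normc (cell n (w, t)) <= expR (- Re alpha * t).
Proof.
rewrite normcM normc_toC normc_cexpn ler_piMr ?expR_ge0// indicE.
by case: (_ \in _); rewrite ?normr1 ?normr0.
Qed.

Let cint_cell n w : G w -> cint leb half (fun t => cell n (w, t)) =
  toC (\1_(path n) w) * ((cexpn alpha (J n w) - cexpn alpha (J n.+1 w)) / alpha).
Proof.
move=> wG; have /andP[J0 JJ] := JG wG (leqnSn n).
rewrite -cint_cexpn_indic//.
rewrite indicE; have [/set_mem pw|pw] := boolP (w \in path n).
  rewrite mul1r; apply: eq_cint => t _; rewrite /cell; congr (_ * toC _).
  rewrite indicE; congr (nat_of_bool _)%:R.
  by apply/idP/idP => [/set_mem[_ [-> ->]]//|/andP[h1 h2]]; rewrite inE.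
rewrite mul0r (@eq_cint _ _ _ _ _ _ (fun=> 0)) => [|t _].
  by rewrite /cint /= Rintegral_cst// mul0r.
rewrite /cell indicE memNset ?mulr0// => -[pw' _].
by move: pw; rewrite notin_setE; exact.
Qed.

Let Xb : set (T * RM) := [set p | Xbefore Y H B p.2 y p.1].
Let XbE : ~ B y -> Xb = \bigcup_n rect n.
Proof.
move=> By; apply/seteqP; split=> p.
  move=> [n [Yn [/andP[h1 h2] h3]]]; exists n => //; split=> //.
  by split=> // k /andP[k0 /ltnW kn]; exact: h3.
move=> [n _ [[h Yn] [h1 h2]]]; exists n; split=> //; split; first by rewrite h1.
move=> k k0; rewrite leq_eqVlt => /predU1P[->|kn]; first by rewrite Yn.
by apply: h; rewrite k0.
Qed.

Let full (p : T * RM) : C := cexpn alpha p.2 * toC (\1_Xb p).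
Let mXb : ~ B y -> measurable Xb.
Proof. by move=> By; rewrite XbE//; apply: bigcupT_measurable. Qed.
Let mfull : ~ B y -> cmeas setT full.
Proof.
move=> By; apply: cmeasM; [exact: cmeas_cexpn|apply: cmeas_toC].
by apply: measurable_indic; exact: mXb.
Qed.
Let full_le w t : normc (full (w, t)) <= expR (- Re alpha * t).
Proof.
rewrite normcM normc_toC normc_cexpn ler_piMr ?expR_ge0// indicE.
by case: (_ \in _); rewrite ?normr1 ?normr0.
Qed.

Let cell_single w t n m : G w -> cell n (w, t) != 0 -> cell m (w, t) != 0 -> n = m.
Proof.
move=> wG.
have cN k : cell k (w, t) != 0 -> J k w <= t < J k.+1 w.
  rewrite /cell indicE; have [/set_mem[_ [/= -> ->]]//|_] := boolP (_ \in _).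
  by rewrite mulr0 eqxx.
wlog: n m / (n <= m)%N => [hw cn cm|].
  by case/orP: (leq_total n m) => nm; [exact: hw|apply/esym/hw].
rewrite leq_eqVlt => /predU1P[//|nm] /cN/andP[_ h1] /cN/andP[h2 _].
have /andP[_ h3] := JG wG nm.
by have := lt_le_trans h1 (le_trans h3 h2); rewrite ltxx.
Qed.

Let has_csum_cell w : ~ B y -> G w ->
  has_csum (fun n => cint leb half (fun t => cell n (w, t))) (cint leb half (fun t => full (w, t))).
Proof.
move=> By wG.
apply: (@cint_csum _ RM R leb half (fun n t => cell n (w, t)) (fun t => full (w, t))
  (fun t => expR (- Re alpha * t))) => //.
- move=> n; have [m1 m2] := mcell n.
  by split; apply: measurable_funTS; [exact: (measurableT_comp m1)|exact: (measurableT_comp m2)].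
- exact: integrable_expR_half.
- move=> n t _; apply: (@sum_single_le R (fun k => cell k (w, t))); first exact: expR_ge0.
    by move=> k; exact: cell_le.
  by move=> k l; exact: cell_single.
move=> t _; have [[m cm]|/forallNP c0] := pselect (exists m, cell m (w, t) != 0).
  rewrite (_ : full (w, t) = cell m (w, t)).
    apply: has_csum_single => n nm; apply/eqP; apply: contraT => cn.
    by rewrite (cell_single wG cn cm) eqxx in nm.
  rewrite /full /cell; congr (_ * toC _); rewrite !indicE; congr (nat_of_bool _)%:R.
  move: cm; rewrite /cell indicE; have [/set_mem r _|_] := boolP (_ \in rect m); last first.
    by rewrite mulr0 eqxx.
  by rewrite XbE// mem_set//; exists m.
rewrite (_ : full (w, t) = cell 0 (w, t)).
  by apply: has_csum_single => n _; apply/eqP; apply: contraT => /c0.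
have /negP := c0 0%N; rewrite negbK => /eqP ->.
rewrite /full indicE memNset ?mulr0// XbE// => -[n _ rn].
(* At a point of [rect n] the vanishing of [cell n] would force the exponential to vanish, although
   its norm is positive. *)
have := c0 n; rewrite /cell indicE mem_set// mulr1 => /negP; rewrite negbK => /eqP e0.
by have := normc_cexpn alpha t; rewrite e0 normc0 => /eqP; rewrite lt_eqF// expR_gt0.
Qed.

(** Time is cut into the sojourns [J_n, J_{n+1}[ in [y]. Each contributes the difference of the
    transforms of J_n and J_{n+1} divided by alpha, that is [tab] times (1 - q / (q + alpha)) /
    alpha = 1 / (q + alpha), with q the total rate at [y]. *)
Lemma occLTE : ~ B y -> occLT P Y H B y alpha = green q alpha A y z0 / kden q alpha y.
Proof.
move=> By.
have ih := integrable_expR_half alpha_gt0.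
have mS := cmeas_cinner P (mfull By) ih (fun w t _ => full_le w t).
have mI n := cmeas_cinner P (mcell n) ih (fun w t _ => cell_le n w t).
have mGc : cmeas setT (fun w => toC (\1_G w : R)).
  by apply: cmeas_toC; exact: measurable_indic.
have al0 : alpha != 0 by apply/eqP => e; move: alpha_gt0; rewrite e ltxx.
have -> : occLT P Y H B y alpha =
    cint P setT (fun w => toC (\1_G w) * cint leb half (fun t => full (w, t))).
  apply: ae_eq_cint => //; first exact: cmeasM.
  by apply: filterS aeG => w wG _; rewrite indicE wG mul1r.
have h : has_csum (fun n => cint P setT (fun w => toC (\1_G w) * cint leb half (fun t => cell n (w, t))))
    (cint P setT (fun w => toC (\1_G w) * cint leb half (fun t => full (w, t)))).
  pose M := Rintegral leb half (fun t => expR (- Re alpha * t)).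
  have M0 : 0 <= M by apply: Rintegral_ge0 => t _; exact: expR_ge0.
  (* At each time at most one cell is active, so any partial sum is dominated by exp(- Re alpha t).
     [M] is the integral of this bound, counted once for the real and once for the imaginary
     part. *)
  apply: (cint_csum (g := cst (M + M))) => //.
  - by move=> n; exact: cmeasM.
  - exact: finite_measure_integrable_cst.
  - move=> n w _; rewrite /cst -mulr_sumr normcM indicE.
    have [/set_mem wG|_] := boolP (w \in G); last first.
      by rewrite normc_toC normr0 mul0r addr_ge0.
    rewrite normc_toC normr1 mul1r.
    have mc k : cmeas half (fun t => cell k (w, t)).
      have [m1 m2] := mcell k.
      by split; apply: measurable_funTS; [exact: (measurableT_comp m1)|exact: (measurableT_comp m2)].
    have ic k : cintegrable leb half (fun t => cell k (w, t)).
      by apply: (cintegrable_le _ (mc k) ih) => // t _; exact: cell_le.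
    rewrite -(cint_sum (index_enum 'I_n) (F := fun k t => cell k (w, t)) _ ic).2//.
    apply: cint_norm_le => //; first exact: cmeas_sum.
    move=> t _; apply: (@sum_single_le R (fun k => cell k (w, t))); first exact: expR_ge0.
      by move=> k; exact: cell_le.
    by move=> k l; exact: cell_single.
  - move=> w _; have [wG|wG] := pselect (G w).
      by apply: has_csumZ; exact: has_csum_cell.
    rewrite indicE memNset// mul0r; under eq_fun do rewrite mul0r.
    exact: has_csum0.
rewrite -(has_csumE h); apply: has_csumE.
rewrite mulrC (_ : (fun n => _) = (fun n => (kden q alpha y)^-1 * tab q alpha A y n z0)).
  apply: has_csumZ; exact: has_csum_green.
apply/funext => n.
have k0 : kden q alpha y != 0 by apply: kden_neq0.
pose F b w : C := toC (\1_G w) * (toC (\1_(path n) w) * cexpn alpha (J (n + nat_of_bool b) w)).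
have iF b : cintegrable P setT (F b).
  apply: (@cintegrable_bounded _ _ _ _ _ 1).
    do 2 (apply: cmeasM; first by apply: cmeas_toC; exact: measurable_indic).
    exact: cmeas_cexpn.
  move=> w; rewrite /F indicE; have [/set_mem wG|_] := boolP (w \in G); last first.
    by rewrite mul0r normc0.
  rewrite mul1r indicE; case: (_ \in _); last by rewrite mul0r normc0.
  rewrite mul1r normc_cexpn_le1 ?(ltW alpha_gt0)//.
  by have /andP[] := JG wG (leqnn (n + b)).
rewrite (_ : (fun w => _) = (fun w => alpha^-1 * (F false w + (-1) * F true w))).
  rewrite cintZ//; last by apply: cintegrableD => //; exact: cintegrableZ.
  rewrite cintD//; last exact: cintegrableZ.
  rewrite cintZ// !cint_path /kstay.
  have -> : toC (qtot q y) = kden q alpha y - alpha by rewrite /kden addrK.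
  by field; rewrite al0 k0.
apply/funext => w; rewrite /F indicE; have [/set_mem wG|_] := boolP (w \in G).
  by rewrite !mul1r cint_cell// addn0 addn1; field.
by rewrite !mul0r mulr0 addr0 mulr0.
Qed.

(** With an empty taboo set nothing is killed, and Fubini moves the expectation inside the time
    integral. *)
Lemma piLT_occLT : B = set0 -> piLT P Y H y alpha = occLT P Y H B y alpha.
Proof.
move=> B0; have By : ~ B y by rewrite B0.
rewrite /piLT /occLT (cfubini P (g := full) (mfull By) (integrable_expR_half alpha_gt0)); last first.
  by move=> w t _; exact: full_le.
apply: eq_cint => t _.
have mX : measurable [set w | Xbefore Y H B t y w].
  have := measurable_ysection t (mXb By).
  by rewrite (_ : ysection _ _ = [set w | Xbefore Y H B t y w])//;
    apply/seteqP; split=> w; rewrite /ysection /= inE.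
rewrite (_ : Xat Y H t y = [set w | Xbefore Y H B t y w]); last first.
  apply/seteqP; split=> w [n].
    by move=> [h1 h2]; exists n; split=> //; split=> // k _ _; rewrite B0.
  by move=> [h1 [h2 _]]; exists n.
rewrite -cint_indic// -cintZ//.
  apply: (@cintegrable_bounded _ _ _ _ _ 1).
    by apply: cmeas_toC; exact: measurable_indic.
  by move=> w; rewrite normc_toC indicE; case: (_ \in _); rewrite ?normr1 ?normr0.
Qed.

End Transforms.

End Chain.

(** * Path decompositions *)

Lemma nbP (z y : state) : y \in nb z -> [\/ y = (z.1.+1, z.2), y = (z.1, z.2.+1),
  (0 < z.1)%N /\ y = (z.1.-1, z.2) | (0 < z.2)%N /\ y = (z.1, z.2.-1)].
Proof.
rewrite /nb !mem_cat !inE -orbA => /or3P[/eqP ->|/eqP ->|/orP[]].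
- by constructor 1.
- by constructor 2.
- by case: ifP => // z1; rewrite inE => /eqP ->; constructor 3.
- by case: ifP => // z2; rewrite inE => /eqP ->; constructor 4.
Qed.

Section Decomposition.
Variables (R : realType) (q : nnrates R) (alpha : R[i]) (Q : R).
Local Notation C := (R[i]).
Local Notation Re := complex.Re.
Local Notation toC x := (Complex x 0).
Hypothesis q_ge0 : forall z y, 0 <= qrate q z y.
Hypothesis q_gt0 : forall z, 0 < qtot q z.
Hypothesis q_le : forall z, qtot q z <= Q.
Hypothesis alpha_gt0 : 0 < Re alpha.
Local Notation kop := (kop q alpha).
Local Notation green := (green q alpha).
Local Notation hits := (hits q alpha).
Let green_eq := green_eq q_ge0 q_gt0 q_le alpha_gt0.
Let hits_eq := hits_eq q_ge0 q_gt0 q_le alpha_gt0.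
Let kop_fix0 := kop_fix0 q_ge0 q_gt0 q_le alpha_gt0.

(** Neighbours of rate 0 may be ignored. In the model this discards the jumps to a lower level from
    phases at least [c]. *)
Lemma eq_kop_supp (f g : state -> C) z :
  (forall y, y \in nb z -> qrate q z y != 0 -> f y = g y) -> kop f z = kop g z.
Proof.
move=> fg; apply: eq_big_seq => y yz; have [q0|q0] := eqVneq (qrate q z y) 0.
  by rewrite /kernel q0 !mul0r.
by rewrite fg.
Qed.

(** If the sum is at most 1 + kratio^n M everywhere, one step of the equation improves this to 1 +
    kratio^(n+1) M: a vertex outside [A] equals at most one target and so costs at most 1. The crude
    start [M] grows with the number of targets but disappears in the limit. *)
Lemma sum_normc_hits_le (A : pred state) (ts : seq state) z :
  uniq ts -> (forall t, t \in ts -> ~~ A t) ->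
  \sum_(t <- ts) normc (hits A t z) <= 1.
Proof.
move=> uts At.
have [K hK] := hits_bounded q_ge0 q_gt0 q_le alpha_gt0.
have r0 := kratio_ge0 q_gt0 q_le alpha_gt0.
have r1 := kratio_lt1 q_gt0 q_le alpha_gt0.
have K0 : 0 <= K := le_trans (normc_ge0 _) (hK A z z).
pose M := \sum_(t <- ts) K.
have M0 : 0 <= M by rewrite sumr_ge0.
apply: (kratio_limit q_gt0 q_le alpha_gt0 (c := M)) => n; elim: n z => [|n IH] z.
  rewrite mul1r; apply: (@le_trans _ _ M); last by rewrite lerDr.
  by apply: ler_sum => t _; exact: hK.
pose B := 1 + kratio alpha Q ^+ n * M.
have B1 : 1 <= B by rewrite lerDl mulr_ge0// exprn_ge0.
have B0 : 0 <= B := le_trans ler01 B1.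
apply: (@le_trans _ _ (kratio alpha Q * B)); last first.
  by rewrite /B mulrDr mulr1 exprS mulrA lerD2r ltW.
rewrite (eq_big_seq (fun t => normc (kop (fun y => if A y then hits A t y else (y == t)%:R) z)));
  last by move=> t tts; rewrite hits_eq// At.
apply: (kop_sum_le q_ge0 q_gt0 q_le alpha_gt0) => // y.
have [Ay|Ay] := boolP (A y); first exact: IH.
apply: le_trans B1.
rewrite (eq_bigr (fun t => if t == y then 1 else 0)); last first.
  by move=> t _; rewrite eq_sym; case: eqP => _; rewrite ?normc1 ?normc0.
have [yts|yts] := boolP (y \in ts).
  by rewrite (@big_pred1_seq_uniq R _ ts y (fun=> 1)).
by rewrite big1_seq// => t /= tts; case: eqP => // ty; move: yts; rewrite -ty tts.
Qed.

(** The difference of the two sides solves u = K u at every state. Off [Bs], [k z] and the point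
    source at [x] make up [green A x z]; on [Bs], [k z] cancels against the point source of
    [green predT z]. *)
Lemma green_last_exit (A : pred state) (Bs : seq state) x z : uniq Bs ->
  (forall y, A y = (y \notin Bs)) -> A x ->
  green predT x z = (if A z then green A x z else 0) +
    \sum_(b <- Bs) green predT b z * kop (fun y => if A y then green A x y else 0) b.
Proof.
move=> uB AE Ax; set k := kop _.
have [K hK] := green_bounded q_ge0 q_gt0 q_le alpha_gt0.
have K0 : 0 <= K := le_trans (normc_ge0 _) (hK A x x).
apply/eqP; rewrite -subr_eq0 opprD addrA; apply/eqP; move: z.
apply: (kop_fix0 (B := K + K + \sum_(b <- Bs) K * normc (k b))) => [z|z].
  apply: le_trans (le_normcD _ _) _; rewrite normcN lerD//.
    apply: le_trans (le_normcD _ _) _; rewrite normcN lerD//.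
    by case: ifP => _; rewrite ?normc0.
  apply: le_trans (normc_sum _ _) _; apply: ler_sum => b _.
  by rewrite normcM ler_wpM2r ?normc_ge0.
right; rewrite kopB kopB kop_sum.
have gT b : kop (green predT b) z = green predT b z - (z == b)%:R.
  by rewrite (green_eq z (isT : predT b)) addrC addKr.
have -> : \sum_(b <- Bs) kop (fun y => green predT b y * k b) z =
    \sum_(b <- Bs) green predT b z * k b - \sum_(b <- Bs) (if b == z then k b else 0).
  rewrite -sumrB; apply: eq_bigr => b _.
  rewrite (_ : kop _ z = kop (green predT b) z * k b); last first.
    by rewrite [RHS]mulrC -kopZ; apply: eq_kop => y _; rewrite mulrC.
  rewrite gT mulrBl eq_sym; congr (_ - _).
  by case: eqP => _; rewrite ?mul1r ?mul0r.
rewrite gT -/(k z).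
have [zB|zB] := boolP (z \in Bs).
  rewrite (big_pred1_seq_uniq k uB zB) AE zB /=.
  rewrite (_ : (z == x) = false); last by apply/negP => /eqP zx; move: Ax; rewrite AE -zx zB.
  by rewrite subr0; ring.
rewrite [\sum_(b <- Bs) (if b == z then _ else _)]big1_seq; last first.
  by move=> b /= bB; case: eqP => // bz; move: zB; rewrite -bz bB.
rewrite AE zB (green_eq z Ax) -/(k z); ring.
Qed.

(** Decomposition at the first entry into [Ts], the only way out of the region [Rg]. At a point of
    [Ts] the weight [hits A' t] is replaced by the indicator of [t], so the difference is 0 there,
    in agreement with its cut-off outside [Rg]. *)
Lemma green_first_hit (A A' : pred state) (Rg : pred state) (Ts : seq state) x z :
  uniq Ts -> A x -> ~~ Rg x ->
  (forall y, Rg y -> A y && A' y) -> (forall t, t \in Ts -> A t && ~~ A' t) ->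
  (forall y y', Rg y -> y' \in nb y -> qrate q y y' != 0 -> Rg y' || (y' \in Ts)) ->
  Rg z -> green A x z = \sum_(t <- Ts) hits A' t z * green A x t.
Proof.
move=> uT Ax Rx RA TA Rstep Rz.
have [K hK] := green_bounded q_ge0 q_gt0 q_le alpha_gt0.
have [L hL] := hits_bounded q_ge0 q_gt0 q_le alpha_gt0.
have K0 : 0 <= K := le_trans (normc_ge0 _) (hK A x x).
have L0 : 0 <= L := le_trans (normc_ge0 _) (hL A x x).
pose u y := if Rg y then green A x y - \sum_(t <- Ts) hits A' t y * green A x t else 0.
suff : u z = 0 by rewrite /u Rz => /eqP; rewrite subr_eq0 => /eqP.
apply: (kop_fix0 (B := K + \sum_(t <- Ts) L * K)) => y; rewrite /u; last first.
  case: ifP => Ry; [right|by left].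
  rewrite (green_eq y Ax) (_ : (y == x) = false) ?add0r; last first.
    by apply/negP => /eqP yx; move: Rx; rewrite -yx Ry.
  rewrite (eq_big_seq (fun t => kop (fun y' => (if A' y' then hits A' t y' else (y' == t)%:R)
      * green A x t) y)); last first.
    move=> t tT; have /andP[_ At] := TA t tT.
    by rewrite hits_eq// mulrC -kopZ; apply: eq_kop => y' _; rewrite mulrC.
  rewrite -kop_sum -kopB; apply: eq_kop_supp => y' yy' qy'.
  have := Rstep y y' Ry yy' qy'; have [Ry' _|_ /= y'T] := boolP (Rg y').
    by have /andP[-> ->] := RA y' Ry'.
  have /andP[-> /negbTE ->] := TA y' y'T.
  rewrite (eq_bigr (fun t => if t == y' then green A x t else 0)); last first.
    by move=> t _; rewrite eq_sym; case: eqP => _; rewrite ?mul1r ?mul0r.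
  by rewrite (big_pred1_seq_uniq (green A x) uT y'T) subrr.
case: ifP => _; last by rewrite normc0 addr_ge0// sumr_ge0// => t _; rewrite mulr_ge0.
apply: le_trans (le_normcD _ _) _; rewrite normcN lerD//.
apply: le_trans (normc_sum _ _) _; apply: ler_sum => t _.
by rewrite normcM ler_pM ?normc_ge0.
Qed.

(** A path started in [Rg] is killed under [A], and likewise under [A'], exactly when it leaves
    [Rg]; the two taboos cannot be told apart from inside. *)
Lemma green_eq_region (A A' : pred state) (Rg : pred state) x z : A x -> A' x ->
  (forall y y', Rg y -> y' \in nb y -> qrate q y y' != 0 ->
     (A y' == A' y') && (A y' == Rg y')) ->
  Rg z -> green A x z = green A' x z.
Proof.
move=> Ax Ax' Rstep Rz.
have [K hK] := green_bounded q_ge0 q_gt0 q_le alpha_gt0.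
have K0 : 0 <= K := le_trans (normc_ge0 _) (hK A x x).
pose u y := if Rg y then green A x y - green A' x y else 0.
suff : u z = 0 by rewrite /u Rz => /eqP; rewrite subr_eq0 => /eqP.
apply: (kop_fix0 (B := K + K)) => y; rewrite /u; last first.
  case: ifP => Ry; [right|by left].
  rewrite (green_eq y Ax) (green_eq y Ax') opprD addrACA subrr add0r -kopB.
  apply: eq_kop_supp => y' yy' qy'.
  have /andP[/eqP <- /eqP <-] := Rstep y y' Ry yy' qy'.
  by case: ifP; rewrite ?subrr.
case: ifP => _; last by rewrite normc0 addr_ge0.
by apply: le_trans (le_normcD _ _) _; rewrite normcN lerD.
Qed.

End Decomposition.

Lemma qrate_ge0 (R : realType) (q : nnrates R) :
  (forall i j, 0 <= r_right q i j) -> (forall i j, 0 <= r_up q i j) ->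
  (forall i j, 0 <= r_left q i j) -> (forall i j, 0 <= r_down q i j) ->
  forall z y, 0 <= qrate q z y.
Proof. by move=> *; rewrite /qrate; do 4 (case: ifP => _ //). Qed.

Lemma sum_iota (V : nmodType) n (F : nat -> V) :
  \sum_(j <- iota 0 n) F j = \sum_(j < n) F j.
Proof. by rewrite -[in LHS](subn0 n) -/(index_iota 0 n) big_mkord. Qed.

(** * The queueing model *)

Definition outside c i : pred state := fun y => ~~ ((y.1 <= i)%N && (y.2 < c)%N).
Definition off_level c k : pred state := fun y => ~~ ((y.1 == k) && (y.2 < c)%N).
Definition busy : pred state := fun y => y.1 != 0%N.

Section Model.
Variables (R : realType) (c : nat) (l1 l2 m1 m2 : R) (alpha : R[i]).
Local Notation C := (R[i]).
Local Notation Re := complex.Re.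
Local Notation toC x := (Complex x 0).
Hypotheses (l1_gt0 : 0 < l1) (l2_gt0 : 0 < l2) (m1_gt0 : 0 < m1) (m2_gt0 : 0 < m2).
Hypothesis alpha_gt0 : 0 < Re alpha.

Local Notation qm := (model_rates c l1 l2 m1 m2).
Local Notation qb := (mm1_poisson_rates l2 (c%:R * m2) l1).
Local Notation Qm := (l1 + l2 + c%:R * m1 + c%:R * m2).

Lemma model_qrate_ge0 z y : 0 <= qrate qm z y.
Proof.
by apply: qrate_ge0 => i j /=; first [exact: ltW | by rewrite mulr_ge0// ltW].
Qed.
Lemma mm1_qrate_ge0 z y : 0 <= qrate qb z y.
Proof.
by apply: qrate_ge0 => i j //=; first [exact: ltW | by rewrite mulr_ge0// ltW].
Qed.
Lemma model_qtot_gt0 z : 0 < qtot qm z.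
Proof.
rewrite /qtot /=; do 2 (apply: ltr_wpDr; first by case: ifP => // _; rewrite mulr_ge0// ltW).
by rewrite addr_gt0.
Qed.
Lemma mm1_qtot_gt0 z : 0 < qtot qb z.
Proof.
rewrite /qtot /=; apply: ltr_wpDr; first by case: ifP.
apply: ltr_wpDr; first by case: ifP => // _; rewrite mulr_ge0// ltW.
by rewrite addr_gt0.
Qed.
Lemma model_qtot_le z : qtot qm z <= Qm.
Proof.
have cm m : 0 < m -> 0 <= c%:R * m by move=> m0; rewrite mulr_ge0// ltW.
rewrite /qtot /=; apply: lerD; first apply: lerD => //.
  case: ifP => _; last exact: cm.
  by rewrite ler_wpM2r ?(ltW m1_gt0)// ler_nat (leq_trans (geq_minr _ _))// leq_subr.
case: ifP => _; last exact: cm.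
by rewrite ler_wpM2r ?(ltW m2_gt0)// ler_nat geq_minl.
Qed.
Lemma mm1_qtot_le z : qtot qb z <= l2 + l1 + c%:R * m2.
Proof.
rewrite /qtot /= [X in _ + X](_ : _ = 0); last by case: ifP.
rewrite addr0 lerD2l; case: ifP => // _; by rewrite mulr_ge0// ltW.
Qed.

Local Notation kop := (kop qm alpha).
Local Notation green := (green qm alpha).

Lemma model_left0 z : (c <= z.2)%N -> r_left qm z.1 z.2 = 0.
Proof. by move=> cz /=; rewrite (eqP cz) minn0 mul0r. Qed.

Lemma model_left_phase z : (0 < z.1)%N -> qrate qm z (z.1.-1, z.2) != 0 -> (z.2 < c)%N.
Proof.
by move=> z0; rewrite qrate_left// ltnNge; apply: contraNN => /model_left0 ->.
Qed.

Variables (i l : nat).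
Local Notation x := (i.+1, l).

Local Notation A := (outside c i).
Local Notation lev := (off_level c).

Let Ax : A x. Proof. by rewrite /outside /= ltnn. Qed.

(** [Nmx] kills on the single level L_i, the last-exit decomposition on L_0, ..., L_i. From above
    level i the first descent to level i is a left jump, hence in a phase below [c], and ends in
    L_i, so both kill at the same moment. *)
Lemma green_above z : (i < z.1)%N -> green A x z = green (lev i) x z.
Proof.
move=> iz; apply: (green_eq_region model_qrate_ge0 model_qtot_gt0 model_qtot_le alpha_gt0
  (Rg := fun y => (i < y.1)%N)) => //.
  by rewrite /off_level /= gtn_eqF.
move=> y y' iy /nbP[->|->|[y1 ->]|[y2 ->]] qy; rewrite /outside /off_level /=; try by lia.
have := model_left_phase y1 qy; lia.
Qed.

Lemma green_hits z : (i.+1 < z.1)%N ->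
  green A x z = \sum_(j < c) hits qm alpha (lev i.+1) (i.+1, nat_of_ord j) z
                * green A x (i.+1, nat_of_ord j).
Proof.
move=> iz; pose Ts := [seq (i.+1, j) | j <- iota 0 c].
rewrite (@green_first_hit _ qm alpha Qm model_qrate_ge0 model_qtot_gt0 model_qtot_le alpha_gt0
  A (lev i.+1) (fun y => (i.+1 < y.1)%N) Ts) => //.
- by rewrite /Ts big_map sum_iota.
- by rewrite map_inj_uniq ?iota_uniq// => j j' [].
- by rewrite /= ltnn.
- by move=> y iy; rewrite /outside /off_level; lia.
- move=> t /mapP[j]; rewrite mem_iota add0n => /andP[_ jc] ->.
  by rewrite /outside /off_level /=; lia.
move=> y y' iy /nbP[->|->|[y1 ->]|[y2 ->]] qy /=; try by apply/orP; left; lia.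
have yc := model_left_phase y1 qy.
have [//|iy'] := ltnP i.+1 y.1.-1; apply/orP; right.
by apply/mapP; exists y.2; rewrite ?mem_iota//; congr pair; lia.
Qed.

(** * Excursions above phase c-1 as busy periods *)

Local Notation Ab := busy.
(** The coordinates are swapped with respect to the model: queue length n stands for phase c - 1 +
    n, and the counter for the increase of the level. *)
Local Notation hb m n := (hits qb alpha Ab (@pair nat nat 0%N m) (@pair nat nat n 0%N)).

(** The rates of the queue do not depend on the counter, and the downward jump of the counter has
    rate 0, so the start and the target may be shifted together. *)
Let tab_shift m N n p :
  tab qb alpha Ab (0%N, m.+1) N (n, p.+1) = tab qb alpha Ab (0%N, m) N (n, p).
Proof.
elim: N n p => [|N IH] n p; first by rewrite /= !xpair_eqE eqSS.
rewrite /= !kopE /= !IH.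
rewrite (_ : kden qb alpha (n, p.+1) = kden qb alpha (n, p)); last first.
  by rewrite /kden /qtot /=; case: (0 < p)%N.
congr (_ / _); congr (_ + _ + _ + _).
by rewrite (_ : toC 0 = 0)// mul0r; case: ifP => // _; rewrite mul0r.
Qed.

Let tab_shift0 N n p : tab qb alpha Ab (0%N, 0%N) N (n, p.+1) = 0.
Proof.
elim: N n p => [|N IH] n p; first by rewrite /= xpair_eqE andbF.
rewrite /= kopE /= !IH !if_same !mulr0 !add0r mul0r.
by rewrite !(if_same, mulr0, addr0, mul0r).
Qed.

Let hits_shift m n :
  hits qb alpha Ab (0%N, m) (n, 1%N) = if m is m'.+1 then hb m' n else 0.
Proof.
case: m => [|m]; rewrite /hits.
  by rewrite (_ : (fun n => _) = fun=> 0);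
    [exact/has_csumE/has_csum0|apply/funext => N; rewrite tab_shift0].
by congr csum; apply/funext => N; rewrite tab_shift.
Qed.

Let hb_eq m n : (0 < n)%N -> hb m n =
  (toC l2 * hb m n.+1 + toC l1 * (if m is m'.+1 then hb m' n else 0)
  + toC (c%:R * m2) * (if n == 1%N then (m == 0%N)%:R else hb m n.-1))
  / (toC (l1 + l2 + c%:R * m2) + alpha).
Proof.
move=> n0; rewrite (hits_eq mm1_qrate_ge0 mm1_qtot_gt0 mm1_qtot_le alpha_gt0) ?kopE//=.
have An p : Ab (n, p) by rewrite /busy /= -lt0n.
rewrite An n0 hits_shift addr0; congr (_ / _); last first.
  by rewrite /kden /qtot /= n0 addr0 [l2 + l1]addrC.
congr (_ + _ * _); case: n n0 {An} => [//|[|n]] _ /=; last by [].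
by rewrite xpair_eqE eqxx /= eq_sym.
Qed.

Let hb_sum M n : \sum_(m < M) normc (hb m n) <= 1.
Proof.
have := sum_normc_hits_le mm1_qrate_ge0 mm1_qtot_gt0 mm1_qtot_le alpha_gt0 (A := Ab)
  (ts := [seq (0%N, m) | m <- iota 0 M]) (n, 0%N).
rewrite big_map sum_iota; apply.
  by rewrite map_inj_uniq ?iota_uniq// => j j' [].
by move=> t /mapP[j _ ->].
Qed.

(** The cut-off expresses killing: for k <= i the state (k, c-1) belongs to L_k. *)
Local Notation V k := (if (i < k)%N then green A x (k, c.-1) else 0).

(* From level [k] and phase [c.-1 + n], the phase returns to [c.-1] at level
   [k + m] with weight [hb m n]. *)
Let F k n : C := csum (fun m => hb m n * V (k + m)%N).

Let V_bounded : exists2 B, 0 <= B & forall k, normc (V k) <= B.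
Proof.
have [B hB] := green_bounded model_qrate_ge0 model_qtot_gt0 model_qtot_le alpha_gt0.
have B0 : 0 <= B := le_trans (normc_ge0 _) (hB A x x).
by exists B => // k; case: ifP => _; rewrite ?normc0.
Qed.

Let F_sum B k n M : 0 <= B -> (forall k, normc (V k) <= B) ->
  \sum_(m < M) normc (hb m n * V (k + m)%N) <= B.
Proof.
move=> B0 hB; rewrite -[X in _ <= X]mul1r.
apply: (@le_trans _ _ (\sum_(m < M) normc (hb m n) * B)).
  by apply: ler_sum => m _; rewrite normcM ler_wpM2l ?normc_ge0.
by rewrite -mulr_suml ler_wpM2r// hb_sum.
Qed.

Let has_csum_F k n : has_csum (fun m => hb m n * V (k + m)%N) (F k n).
Proof.
have [B B0 hB] := V_bounded; apply: ccvg_csum; apply: (@abs_ccvg _ _ B) => M.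
exact: F_sum.
Qed.

(** [hb_eq] summed against [V]. A jump of the counter leaves m - 1 increments out of m to come;
    after reindexing, this is the same sum started one level higher. *)
Let F_eq k n : (0 < n)%N -> F k n =
  (toC l2 * F k n.+1 + toC l1 * F k.+1 n
   + toC (c%:R * m2) * (if n == 1%N then V k else F k n.-1))
  / (toC (l1 + l2 + c%:R * m2) + alpha).
Proof.
move=> n0; rewrite [RHS]mulrC; apply: has_csumE.
rewrite (_ : (fun m => hb m n * V (k + m)%N) = fun m =>
  (toC (l1 + l2 + c%:R * m2) + alpha)^-1 * (toC l2 * (hb m n.+1 * V (k + m)%N)
   + toC l1 * ((if m is m'.+1 then hb m' n else 0) * V (k + m)%N)
   + toC (c%:R * m2) * ((if n == 1%N then (m == 0%N)%:R else hb m n.-1) * V (k + m)%N))); last first.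
  by apply/funext => m; rewrite hb_eq// mulrAC mulrC !mulrDl !mulrA.
apply: has_csumZ; apply: has_csumD; first apply: has_csumD.
- by apply: has_csumZ; exact: has_csum_F.
- apply: has_csumZ.
  have := (has_csum_recl (fun m => (if m is m'.+1 then hb m' n else 0) * V (k + m)%N)
    (F k.+1 n)).1.
  rewrite mul0r add0r; apply.
  by under eq_fun do rewrite addnS -addSn; exact: has_csum_F.
- apply: has_csumZ; case: ifP => _; last exact: has_csum_F.
  have := @has_csum_single R (fun m => (m == 0%N)%:R * V (k + m)%N) 0%N.
  by rewrite eqxx mul1r addn0; apply => m /negbTE ->; rewrite mul0r.
Qed.

Hypothesis c_gt0 : (0 < c)%N.
Hypothesis l_lt : (l < c)%N.

(** In phases at least [c] the model has no left jumps and constant rates l1, l2, c m2, so the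
    killed Green function satisfies the recursion [F_eq] with the same boundary value [V] at phase
    c-1. As l < c, the target contributes no source there, and uniqueness applies. *)
Lemma green_busy k n : (0 < n)%N -> has_csum (fun m => hb m n * V (k + m)%N)
  (green A x (k, c.-1 + n)%N).
Proof.
move=> n0; suff -> : green A x (k, c.-1 + n)%N = F k n by exact: has_csum_F.
have [B B0 hB] := V_bounded.
(* In [u] below, phase c - 1 + n corresponds to n = (y.2 - c) + 1, and the cut-off at phases below
   [c] encodes the zero boundary data of the difference. *)
have [K hK] := green_bounded model_qrate_ge0 model_qtot_gt0 model_qtot_le alpha_gt0.
pose u (y : state) := if (c <= y.2)%N then green A x y - F y.1 (y.2 - c).+1 else 0.
suff : u (k, c.-1 + n)%N = 0.
  rewrite /u /= (_ : (c <= c.-1 + n)%N); last by lia.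
  by rewrite (_ : (c.-1 + n - c).+1 = n); [move=> /eqP; rewrite subr_eq0 => /eqP|lia].
apply: (kop_fix0 model_qrate_ge0 model_qtot_gt0 model_qtot_le alpha_gt0 (B := K + (B + B))) => y.
  rewrite /u; case: ifP => _.
    apply: le_trans (le_normcD _ _) _; rewrite normcN lerD//.
    by apply: csum_bound => M; exact: F_sum.
  by rewrite normc0 !addr_ge0// (le_trans (normc_ge0 _) (hK A x x)).
have [cy|cy] := leqP c y.2; last by left; rewrite /u leqNgt cy.
right; rewrite {1}/u cy.
rewrite (green_eq model_qrate_ge0 model_qtot_gt0 model_qtot_le alpha_gt0 y Ax).
rewrite (_ : (y == x) = false) ?add0r; last first.
  by case: y cy => y1 y2 /= cy; rewrite xpair_eqE; lia.
have y2 : (0 < y.2)%N by lia.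
(* Here min(i, c - j) = 0 and min(c, j) = c, so the total rate is that of the nonempty queue with
   its counter. *)
have den : kden qm alpha y = toC (l1 + l2 + c%:R * m2) + alpha.
  rewrite /kden /qtot y2 -/(r_left qm y.1 y.2) model_left0// if_same addr0 /=.
  by rewrite (minn_idPl cy).
rewrite !kopE den F_eq// -mulrBl; congr (_ / _).
rewrite model_left0// y2 /= !mul0r !if_same !addr0 (minn_idPl cy).
have A1 p : A (p, y.2) by rewrite /outside /= ltnNge cy andbF.
have A2 p : A (p, y.2.+1) by rewrite /outside /= ltnNge (leqW cy) andbF.
rewrite !A1 A2 /u /= cy (leqW cy) subSn//.
have rg (a b e g1 g2 g3 f1 f2 f3 : C) :
    a * g1 + b * g2 + e * g3 - (b * f2 + a * f1 + e * f3) =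
    a * (g1 - f1) + b * (g2 - f2) + e * (g3 - f3) by ring.
have [cy'|cy'] := leqP c y.2.-1.
  rewrite (_ : A (y.1, y.2.-1)); last by rewrite /outside /= ltnNge cy' andbF.
  rewrite (_ : ((y.2 - c).+1 == 1%N) = false); last by lia.
  by rewrite rg (_ : (y.2 - c)%N = (y.2.-1 - c).+1)//; lia.
rewrite (_ : ((y.2 - c).+1 == 1%N)); last by lia.
rewrite (_ : (if A _ then _ else _) = V y.1); first by rewrite rg subrr.
rewrite /outside (_ : y.2.-1 = c.-1) /=; last by lia.
by rewrite ltn_predL c_gt0 andbT -ltnNge.
Qed.

Lemma green_last_level : green predT x (0%N, 0%N) =
  \sum_(j < c) green predT (i, nat_of_ord j) (0%N, 0%N) / kden qm alpha (i, nat_of_ord j)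
     * (toC l1 * green A x (i.+1, nat_of_ord j))
  + \sum_(k < i.+1) green predT (nat_of_ord k, c.-1) (0%N, 0%N) / kden qm alpha (nat_of_ord k, c.-1)
     * (toC l2 * green A x (nat_of_ord k, c)).
Proof.
pose Bs := [seq (k, j) | k <- iota 0 i.+1, j <- iota 0 c].
have uB : uniq Bs by apply: allpairs_uniq; rewrite ?iota_uniq// => -[? ?] [? ?] _ _ [-> ->].
have BsE y : A y = (y \notin Bs).
  congr negb; apply/esym; apply/allpairsP/idP => [[[k j] []]|].
    rewrite !mem_iota !add0n => /andP[_ ki] /andP[_ jc] ->.
    by rewrite /= -[(k <= i)%N]ltnS ki.
  move=> /andP[y1 y2]; exists y; rewrite !mem_iota !add0n /=; split=> //.
  by case: y {y1 y2}.
rewrite (green_last_exit model_qrate_ge0 model_qtot_gt0 model_qtot_le alpha_gt0 _ uB _ Ax)//.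
(* The start (0,0) lies in L_0 since c > 0, so no path avoids the exit set altogether and the first
   term is 0. *)
rewrite {1}/outside /= c_gt0 /= add0r /Bs big_allpairs_dep sum_iota.
have term (k : 'I_i.+1) : \sum_(j <- iota 0 c) green predT (nat_of_ord k, j) (0%N, 0%N)
      * kop (fun y => if A y then green A x y else 0) (nat_of_ord k, j) =
   (if k == ord_max then \sum_(j < c) green predT (i, nat_of_ord j) (0%N, 0%N)
      / kden qm alpha (i, nat_of_ord j) * (toC l1 * green A x (i.+1, nat_of_ord j)) else 0)
   + green predT (nat_of_ord k, c.-1) (0%N, 0%N) / kden qm alpha (nat_of_ord k, c.-1)
     * (toC l2 * green A x (nat_of_ord k, c)).
  have ki : (k <= i)%N by rewrite -ltnS.
  rewrite sum_iota.
  have cc : (c.-1 < c)%N by rewrite ltn_predL.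
  rewrite (eq_bigr (fun j : 'I_c => (if k == ord_max then green predT (i, nat_of_ord j) (0%N, 0%N)
      / kden qm alpha (i, nat_of_ord j) * (toC l1 * green A x (i.+1, nat_of_ord j)) else 0)
    + (if j == Ordinal cc then green predT (nat_of_ord k, nat_of_ord j) (0%N, 0%N)
      / kden qm alpha (nat_of_ord k, nat_of_ord j) * (toC l2 * green A x (nat_of_ord k, c)) else 0))).
    rewrite big_split /= -[X in _ + X]big_mkcond /= big_pred1_eq /=; congr (_ + _).
    by case: ifP => // _; rewrite big1.
  move=> j _; rewrite kopE /=.
  have jc := ltn_ord j.
  (* Left and down jumps stay in L_0, ..., L_i; only a right jump from level i or an up jump from
     phase c-1 leaves. *)
  rewrite (_ : A (k.-1, nat_of_ord j) = false); last by rewrite /outside /=; lia.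
  rewrite (_ : A (nat_of_ord k, j.-1) = false); last by rewrite /outside /=; lia.
  rewrite !mulr0 !if_same !addr0.
  rewrite (_ : A (k.+1, nat_of_ord j) = (k == ord_max)); last first.
    by rewrite -val_eqE /outside /=; lia.
  rewrite (_ : A (nat_of_ord k, j.+1) = (j == Ordinal cc)); last first.
    by rewrite -val_eqE /outside /=; lia.
  have [kE|_] := eqVneq k ord_max; have [jE|_] := eqVneq j (Ordinal cc).
  - by rewrite kE jE /= prednK//; ring.
  - by rewrite kE /=; ring.
  - by rewrite jE /= prednK//; ring.
  - by ring.
by rewrite (eq_bigr _ (fun k _ => term k)) big_split /= -[X in X + _]big_mkcond /= big_pred1_eq.
Qed.

End Model.

(** * Assembling the matrix identity *)

Lemma notin_level c k : (fun y => y \notin level c k) = off_level c k.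
Proof.
apply/funext => y; congr negb; apply/idP/idP => [/set_mem[-> ->]|/andP[/eqP yk yc]].
  by rewrite eqxx.
exact/mem_set.
Qed.

Lemma notin_empty_queue : (fun y : state => y \notin [set z | z.1 = 0%N]) = busy.
Proof.
apply/funext => y; congr negb; apply/idP/idP => [/set_mem /= ->//|/eqP y0].
exact/mem_set.
Qed.

Lemma notin_set0 : (fun y : state => y \notin (set0 : set state)) = predT.
Proof. by apply/funext => y; rewrite in_set0. Qed.

Theorem theorem4 (R : realType) (d : measure_display) (T : measurableType d)
    (P : probability T R) (c : nat) (l1 l2 m1 m2 : R)
    (Y : state -> nat -> T -> state) (H : state -> nat -> T -> R)
    (Yb : nat -> T -> state) (Hb : nat -> T -> R) (alpha : R[i]) :
  (1 <= c)%N -> 0 < l1 -> 0 < l2 -> 0 < m1 -> 0 < m2 ->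
  (* Y z, H z : jump chain and holding times of X started at z *)
  (forall z : state, is_ctmc P (model_rates c l1 l2 m1 m2) z (Y z) (H z)) ->
  (* M/M/1 queue (arrival l2, service c*m2) with independent Poisson(l1) counter *)
  is_ctmc P (mm1_poisson_rates l2 (c%:R * m2) l1) (1%N, 0%N) Yb Hb ->
  0 < complex.Re alpha ->
  forall i : nat,
    let term (k l : nat) : 'rV[R[i]]_c :=
      pivec P c Y H alpha k *m Wmx P c l2 Yb Hb alpha (l - k)
        *m Gmx P c Y H alpha l i.+1 *m Nmx P c Y H alpha i.+1 in
    (forall (k : nat) (col : 'I_c), (k <= i)%N ->
       ccvg (fun n => term k (n + i.+1)%N 0 col)) /\
    pivec P c Y H alpha i.+1 =
      pivec P c Y H alpha i *m A1mx c l1 *m Nmx P c Y H alpha i.+1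
      + \sum_(k < i.+1) \row_(col < c) csum (fun n => term k (n + i.+1)%N 0 col).
Proof.
move=> c0 l10 l20 m10 m20 HX HB a0 i term.
set qm := model_rates c l1 l2 m1 m2; set qb := mm1_poisson_rates l2 (c%:R * m2) l1.
have qm_ge0 := model_qrate_ge0 c l10 l20 m10 m20.
have qb_ge0 := mm1_qrate_ge0 c l10 l20 m20.
have qm_gt0 := model_qtot_gt0 c l10 l20 m10 m20.
have qb_gt0 := mm1_qtot_gt0 c l10 l20 m20.
have qm_le := model_qtot_le c l1 l2 m10 m20.
have qb_le := mm1_qtot_le c l1 l2 m20.
pose p k j : R[i] := green qm alpha predT (k, j) (0%N, 0%N) / kden qm alpha (k, j).
pose gA (col : 'I_c) y := green qm alpha (outside c i) (i.+1, nat_of_ord col) y.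
pose kd (col : 'I_c) := kden qm alpha (i.+1, nat_of_ord col).
have piE k (j : 'I_c) : pivec P c Y H alpha k 0 j = p k j.
  rewrite mxE (piLT_occLT (HX _) a0 _ (erefl set0)).
  by rewrite (occLTE (HX _) qm_gt0 a0 qm_ge0 qm_le)// notin_set0.
have NE (j col : 'I_c) : Nmx P c Y H alpha i.+1 j col = gA col (i.+1, nat_of_ord j) / kd col.
  rewrite mxE (occLTE (HX _) qm_gt0 a0 qm_ge0 qm_le) /=; last by case=> /=; lia.
  (* All Green functions are brought to the single taboo [outside c i], which makes the two sides
     comparable. *)
  by rewrite notin_level /gA (green_above c l10 l20 m10 m20 a0) /=.
have wE m : wbusy P Yb Hb alpha m = hits qb alpha busy (0%N, m) (1%N, 0%N).
  by rewrite /wbusy (hitLTE HB qb_gt0 a0 qb_ge0 qb_le)// notin_empty_queue.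
have cc : (c.-1 < c)%N by rewrite ltn_predL.
pose jc := Ordinal cc.
(* Since W has its only nonzero entry in the corner, just the row c-1 of G N matters. The case n = 0
   uses the convention that G is the identity on the diagonal. *)
have GNE n col : (Gmx P c Y H alpha (n + i.+1) i.+1 *m Nmx P c Y H alpha i.+1) jc col =
    gA col ((n + i.+1)%N, c.-1) / kd col.
  rewrite /Gmx; case: ifP => [/eqP ->|ni]; first by rewrite mul1mx NE.
  rewrite mxE /gA (green_hits c l10 l20 m10 m20 a0)//; last by rewrite /=; lia.
  rewrite mulr_suml; apply: eq_bigr => j _; rewrite NE mulrA; congr (_ * _ / _).
  by rewrite mxE (hitLTE (HX _) qm_gt0 a0 qm_ge0 qm_le) ?notin_level//; split=> //=.
have termE k n col : (k <= i)%N -> term k (n + i.+1)%N 0 col =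
    p k c.-1 * Complex l2 0 / kd col
    * (hits qb alpha busy (0%N, (n + (i.+1 - k))%N) (1%N, 0%N) * gA col ((n + i.+1)%N, c.-1)).
  move=> ki; rewrite /term -[_ *m _ *m _ *m _]mulmxA mxE (bigD1 jc)//= big1 ?addr0; last first.
    move=> j jj; rewrite mxE big1 ?mul0r// => j' _.
    by rewrite !mxE (_ : (nat_of_ord j == c.-1) = false) ?andbF ?mulr0//; exact/negbTE.
  rewrite GNE mxE (bigD1 jc)//= big1 ?addr0; last first.
    move=> j jj; rewrite !mxE (_ : (nat_of_ord j == c.-1) = false) ?mulr0//; exact/negbTE.
  rewrite piE !mxE /= eqxx /= wE addnBA ?(leqW ki)//.
  have rg (x y z u v : R[i]) : x * (y * z) * (u / v) = x * y / v * (z * u) by ring.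
  exact: rg.
(* With m = l - k this is the busy-period series started at m = i + 1 - k; the omitted terms vanish
   because their level k + m is at most i. The excursion starts in phase c, that is n = 1 in
   [green_busy]. *)
have sumE k col : (k <= i)%N -> has_csum (fun n => term k (n + i.+1)%N 0 col)
    (p k c.-1 * Complex l2 0 / kd col * gA col (k, c)).
  move=> ki; under eq_fun => n do rewrite termE//.
  apply: has_csumZ.
  have := green_busy l10 l20 m10 m20 a0 i c0 (ltn_ord col) k (ltn0Sn 0).
  rewrite addn1 prednK// => h.
  rewrite (_ : (fun n => _) = (fun n => hits qb alpha busy (0%N, (n + (i.+1 - k))%N) (1%N, 0%N)
      * (if (i < k + (n + (i.+1 - k)))%N then gA col ((k + (n + (i.+1 - k)))%N, c.-1) else 0))).
    apply: (iffLR (has_csum_shift _ _) h) => n nk.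
    by rewrite ifF ?mulr0//; lia.
  apply/funext => n; rewrite (_ : (k + (n + (i.+1 - k)))%N = (n + i.+1)%N); last by lia.
  by rewrite addnS ltnS leq_addl.
split=> [k col ki|]; first exact: has_csum_ccvg (sumE k col ki).
apply/rowP => col; rewrite piE mxE summxE.
rewrite [X in _ + X](eq_bigr (fun k : 'I_i.+1 => p k c.-1 * Complex l2 0 / kd col * gA col (nat_of_ord k, c))); last first.
  by move=> k _; rewrite mxE; apply/has_csumE/sumE; rewrite -ltnS.
rewrite {1}/p (green_last_level l10 l20 m10 m20 a0 i c0 (ltn_ord col)) mulrDl; congr (_ + _).
  rewrite mxE mulr_suml; apply: eq_bigr => j _.
  rewrite NE mul_mx_scalar mxE piE /p /gA /kd.
  have rg (x y z u v : R[i]) : x / y * (z * u) / v = z * (x / y) * (u / v) by ring.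
  exact: rg.
rewrite mulr_suml; apply: eq_bigr => k _; rewrite /p /gA /kd.
have rg (x y z u v : R[i]) : x / y * (z * u) / v = x / y * z / v * u by ring.
exact: rg.
Qed.
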